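(* Let $R=\mathbb Z_2[x_1^{\pm1},x_2^{\pm1},x_3^{\pm1}]$, $\mathbf a=(a_1,a_2,a_3)^{\mathsf T}\in\mathbb Z_2^3$, and $\mathbf L=(L_1,L_2,L_3)\in\mathbb Z_{>0}^3$. Define $\rho_{\mathbf a}(\mathbf L)=0$ if $a_1L_2L_3=a_2L_3L_1=a_3L_1L_2=0$ in $\mathbb Z_2$, and $\rho_{\mathbf a}(\mathbf L)=1$ otherwise. Then for the model $\mathcal C_{\mathbf a}$, the number of logical qubits on the $\mathbf L$-torus is $$k_{\mathbf a}(\mathbf L)=\log_2\operatorname{GSD}_{\mathbf a}(\mathbf L)=6-2\rho_{\mathbf a}(\mathbf L).$$
   Context: Let $f_i=x_i-1$ for $i=1,2,3$, and $$\partial_1=\begin{pmatrix} f_1 & f_2 & f_3 \end{pmatrix},\quad \partial_2=\begin{pmatrix} 0 & f_3 & -f_2 \\ -f_3 & 0 & f_1 \\ f_2 & -f_1 & 0 \end{pmatrix},\quad \partial_3=\begin{pmatrix} f_1 \\ f_2 \\ f_3 \end{pmatrix}$$ (the Koszul differentials with $K_0=R$, $K_1=K_2=R^3$, $K_3=R$). The CSS model $\mathcal C_{\mathbf a}$ is given by the complex $$K_2\oplus K_3\xrightarrow{\ \mathcal D_{2,\mathbf a}=\begin{pmatrix} \partial_2 & \mathbf a \\ 0 & \partial_3 \end{pmatrix}\ }K_1\oplus K_2\xrightarrow{\ \mathcal D_{1,\mathbf a}=\begin{pmatrix} \partial_1 & -\mathbf a^{\mathsf T} \\ 0 & \partial_2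 \end{pmatrix}\ }K_0\oplus K_1,$$ with $Z$-stabilizer map $\varphi_Z=\mathcal D_{2,\mathbf a}$ and $X$-stabilizer map $\varphi_X=\mathcal D_{1,\mathbf a}^\dagger$ (conjugate transpose, $\overline{x_i}=x_i^{-1}$). Let $R_{\mathbf L}=R/(x_1^{L_1}-1,x_2^{L_2}-1,x_3^{L_3}-1)$. On the $\mathbf L$-periodic torus the $Z$-logical space is $\mathcal H_{Z,\mathbf a}(\mathbf L)=\ker(\mathcal D_{1,\mathbf a}\otimes_RR_{\mathbf L})/\operatorname{im}(\mathcal D_{2,\mathbf a}\otimes_RR_{\mathbf L})$; the number of logical qubits is $k_{\mathbf a}(\mathbf L)=\dim_{\mathbb Z_2}\mathcal H_{Z,\mathbf a}(\mathbf L)$ and the ground-state degeneracy is $\operatorname{GSD}_{\mathbf a}(\mathbf L)=2^{k_{\mathbf a}(\mathbf L)}$. *)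

(* Defs.v *)
From HB Require Import structures.
From mathcomp Require Import all_boot all_order all_algebra finmap.
From mathcomp Require Import boolp.
From mathcomp Require Import monalg.

Set Implicit Arguments.
Unset Strict Implicit.
Unset Printing Implicit Defensive.

Import GRing.Theory.

Local Open Scope ring_scope.
Local Open Scope quotient_scope.

(* The group algebra K[G] of an abelian group G written additively: finitely
   supported functions G -> K under convolution. The ring structure that monalg
   puts on {malg K[G]} requires G to be a monoid without nontrivial units, which
   excludes the exponent groups of Laurent polynomials. *)
Definition galg (K : comNzRingType) (G : zmodType) : Type := {malg K[G]}.

HB.lock Definition gmon (K : comNzRingType) (G : zmodType) (k : G) : galg K G :=
  << 1 *g k >>.

HB.lock Definition galg_scale (K : comNzRingType) (G : zmodType) (c : K)
    (g : galg K G) : galg K G := (c *: g : {malg K[G]}).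

HB.lock Definition galg_mul (K : comNzRingType) (G : zmodType)
    (g1 g2 : galg K G) : galg K G :=
  \sum_(k1 <- msupp g1) \sum_(k2 <- msupp g2)
    (<< g1@_k1 * g2@_k2 *g (k1 + k2) >> : {malg K[G]}).

Section GroupAlgebra.
Variables (K : comNzRingType) (G : zmodType).

HB.instance Definition _ := GRing.Zmodule.copy (galg K G) {malg K[G]}.

Implicit Types (g : galg K G) (k : G) (c : K).

Local Notation galg_mul := (@galg_mul K G).
Local Notation galg_scale := (@galg_scale K G).
Local Notation gmon := (@gmon K G).

Lemma mcoeff_gmon k k' : (gmon k)@_k' = (k == k')%:R.
Proof. by rewrite gmon.unlock mcoeffU. Qed.

Lemma mcoeff_scale c g k : (galg_scale c g)@_k = c * g@_k.
Proof. by rewrite galg_scale.unlock mcoeffZ. Qed.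

Lemma galg_scaleA c d g : galg_scale c (galg_scale d g) = galg_scale (c * d) g.
Proof. by apply/malgP => k; rewrite !mcoeff_scale mulrA. Qed.

Lemma galg_scale1 : left_id 1 galg_scale.
Proof. by move=> g; apply/malgP => k; rewrite mcoeff_scale mul1r. Qed.

Lemma galg_scaleDr : right_distributive galg_scale +%R.
Proof.
by move=> c g h; apply/malgP => k; rewrite !(mcoeffD, mcoeff_scale) mulrDr.
Qed.

Lemma galg_scaleDl g : {morph galg_scale^~ g : c d / c + d}.
Proof.
by move=> c d; apply/malgP => k; rewrite !(mcoeffD, mcoeff_scale) mulrDl.
Qed.

HB.instance Definition _ := GRing.Zmodule_isLmodule.Build K (galg K G)
  galg_scaleA galg_scale1 galg_scaleDr galg_scaleDl.

Lemma galg_mulw (d1 d2 : {fset G}) g1 g2 :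
  (msupp g1 `<=` d1)%fset -> (msupp g2 `<=` d2)%fset ->
  galg_mul g1 g2 =
    \sum_(k1 <- d1) \sum_(k2 <- d2) << g1@_k1 * g2@_k2 *g (k1 + k2) >>.
Proof.
move=> le1 le2; rewrite galg_mul.unlock (big_fset_incl _ le1) /=.
  apply: eq_bigr => k1 _; apply: big_fset_incl => // k _ /mcoeff_outdom ->.
  by rewrite mulr0 monalgU0.
move=> k _ /mcoeff_outdom g1k.
by rewrite big1 // => k' _; rewrite g1k mul0r monalgU0.
Qed.

Lemma galg_mulC : commutative galg_mul.
Proof.
move=> g1 g2; rewrite galg_mul.unlock exchange_big /=.
apply: eq_bigr => k1 _; apply: eq_bigr => k2 _.
by rewrite mulrC addrC.
Qed.

Lemma galg_mulDl : left_distributive galg_mul +%R.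
Proof.
move=> g1 g2 g.
have le := fsubset_refl (msupp g).
rewrite [in RHS](galg_mulw (fsubsetUl _ (msupp g2)) le).
rewrite [in RHS](galg_mulw (fsubsetUr (msupp g1) _) le).
rewrite (galg_mulw (msuppD_le _ _) le) -big_split /=.
apply: eq_bigr => k1 _; rewrite -big_split /=; apply: eq_bigr => k2 _.
by rewrite mcoeffD mulrDl monalgUD.
Qed.

Lemma galg_mulDr : right_distributive galg_mul +%R.
Proof. by move=> g g1 g2; rewrite galg_mulC galg_mulDl !(galg_mulC g). Qed.

Lemma galg_mul0 : left_zero 0 galg_mul.
Proof. by move=> g; rewrite galg_mul.unlock msupp0 big_seq_fset0. Qed.

Lemma galg_mulUU c1 c2 k1 k2 :
  galg_mul << c1 *g k1 >> << c2 *g k2 >> = << c1 * c2 *g (k1 + k2) >>.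
Proof. by rewrite (galg_mulw msuppU_le msuppU_le) !big_seq_fset1 !mcoeffUU. Qed.

Lemma galg_mul_suml (I : Type) (r : seq I) (F : I -> galg K G) g :
  galg_mul (\sum_(i <- r) F i) g = \sum_(i <- r) galg_mul (F i) g.
Proof.
exact: (big_morph (galg_mul^~ g) (fun _ _ => galg_mulDl _ _ _) (galg_mul0 g)).
Qed.

Lemma galg_mul_sumr (I : Type) (r : seq I) (F : I -> galg K G) g :
  galg_mul g (\sum_(i <- r) F i) = \sum_(i <- r) galg_mul g (F i).
Proof.
by rewrite galg_mulC galg_mul_suml; apply: eq_bigr => i _; rewrite galg_mulC.
Qed.

Lemma galg_mulA : associative galg_mul.
Proof.
move=> g1 g2 g3.
rewrite (monalgE g1) galg_mul_suml (galg_mul_suml _ _ g2) galg_mul_suml.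
apply: eq_bigr => k1 _.
rewrite (monalgE g2) (galg_mul_suml _ _ g3) !galg_mul_sumr galg_mul_suml.
apply: eq_bigr => k2 _.
rewrite (monalgE g3) (galg_mul_sumr _ _ << _ *g k2 >>) !galg_mul_sumr.
apply: eq_bigr => k3 _.
by rewrite !galg_mulUU mulrA addrA.
Qed.

Lemma galg_mul1 : left_id (gmon 0) galg_mul.
Proof.
move=> g; rewrite [in LHS](monalgE g) galg_mul_sumr [RHS]monalgE.
by apply: eq_bigr => k _; rewrite gmon.unlock galg_mulUU mul1r add0r.
Qed.

Lemma galg_one_neq0 : gmon 0 != 0.
Proof. by rewrite gmon.unlock monalgU_eq0 oner_eq0. Qed.

HB.instance Definition _ := GRing.Zmodule_isComNzRing.Build (galg K G)
  galg_mulA galg_mulC galg_mul1 galg_mulDl galg_one_neq0.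

Lemma galg_scaleU c c' k :
  c *: (<< c' *g k >> : galg K G) = << c * c' *g k >>.
Proof. by apply/malgP => k'; rewrite [LHS]mcoeff_scale !mcoeffU mulrnAr. Qed.

Lemma galg_scaleAl c g1 g2 : c *: (g1 * g2) = (c *: g1) * g2.
Proof.
suff scaleE g : c *: g = (<< c *g 0 >> : galg K G) * g.
  by rewrite !scaleE mulrA.
rewrite {1}(monalgE g) scaler_sumr [in RHS](monalgE g) [RHS]galg_mul_sumr.
by apply: eq_bigr => k _; rewrite galg_scaleU galg_mulUU add0r.
Qed.

HB.instance Definition _ :=
  GRing.Lmodule_isLalgebra.Build K (galg K G) galg_scaleAl.
HB.instance Definition _ :=
  GRing.Lalgebra_isComAlgebra.Build K (galg K G).

Lemma gmonD k1 k2 : gmon (k1 + k2) = gmon k1 * gmon k2.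
Proof. by rewrite gmon.unlock [RHS]galg_mulUU mulr1. Qed.

Lemma gmonX k n : gmon k ^+ n = gmon (k *+ n).
Proof.
by elim: n => [|n IHn]; rewrite ?expr0 ?mulr0n // exprS mulrS gmonD IHn.
Qed.

Lemma galgE g : g = \sum_(k <- msupp g) g@_k *: gmon k.
Proof.
rewrite {1}(monalgE g); apply: eq_bigr => k _.
by rewrite gmon.unlock galg_scaleU mulr1.
Qed.

Definition aug g : K := \sum_(k <- msupp g) g@_k.

Lemma augw (d : {fset G}) g : (msupp g `<=` d)%fset -> aug g = \sum_(k <- d) g@_k.
Proof.
by move=> le; rewrite /aug (big_fset_incl _ le) // => k _ /mcoeff_outdom ->.
Qed.

Lemma augU c k : aug << c *g k >> = c.
Proof. by rewrite (augw msuppU_le) big_seq_fset1 mcoeffUU. Qed.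

Lemma aug_gmon k : aug (gmon k) = 1.
Proof. by rewrite gmon.unlock augU. Qed.

Lemma aug_zmod : zmod_morphism aug.
Proof.
move=> g1 g2; rewrite (augw (msuppB_le g1 g2)).
rewrite (augw (fsubsetUl (msupp g1) (msupp g2))).
rewrite (augw (fsubsetUr (msupp g1) (msupp g2))) -sumrB.
by apply: eq_bigr => k _; rewrite mcoeffB.
Qed.

HB.instance Definition _ :=
  GRing.isZmodMorphism.Build (galg K G) K aug aug_zmod.

Lemma aug_monoid : monoid_morphism aug.
Proof.
split=> [|g1 g2]; first exact: aug_gmon.
rewrite {1}(galgE g1) {1}(galgE g2) mulr_suml raddf_sum /= [aug g1]/aug mulr_suml.
apply: eq_bigr => k1 _; rewrite mulr_sumr raddf_sum /= [aug g2]/aug mulr_sumr.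
apply: eq_bigr => k2 _.
by rewrite /= gmon.unlock !galg_scaleU [_ * _ in LHS]galg_mulUU augU !mulr1.
Qed.

HB.instance Definition _ :=
  GRing.isMonoidMorphism.Build (galg K G) K aug aug_monoid.

Lemma aug_period g k n : aug (g * (gmon k ^+ n - 1)) = 0.
Proof.
by rewrite gmonX rmorphM rmorphB /= (aug_gmon 0) aug_gmon subrr mulr0.
Qed.

End GroupAlgebra.

(* K[x_1^{+-1}, x_2^{+-1}, x_3^{+-1}] as the group algebra of Z^3. The indices
   1, 2, 3 are represented by 0, 1, 2 : 'I_3, here and for a and L below. *)
Definition laurent (K : fieldType) : comAlgType K := galg K 'rV[int]_3.

Definition xvar (K : fieldType) (i : 'I_3) : laurent K := gmon K (delta_mx 0 i).

Section Torus.
Variables (K : fieldType) (L : 'I_3 -> nat).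
Local Notation laurent := (laurent K).
Local Notation xvar := (xvar K).

Definition torus_ideal : {pred laurent} := fun r =>
  `[< exists g : 'I_3 -> laurent, r = \sum_i g i * (xvar i ^+ L i - 1) >].

Lemma torus_ideal_closed : idealr_closed torus_ideal.
Proof.
split.
- by apply/asboolP; exists (fun=> 0); rewrite big1 // => i _; rewrite mul0r.
- apply/asboolP => -[g /(congr1 (@aug K _))] /eqP.
  rewrite (rmorph1 (@aug K _)) (raddf_sum (@aug K _)) big1 ?oner_eq0 // => i _.
  exact: aug_period.
- move=> r u v /asboolP [g ->] /asboolP [h ->]; apply/asboolP.
  exists (fun i => r * g i + h i); rewrite mulr_sumr -big_split /=.
  by apply: eq_bigr => i _; rewrite mulrDl mulrA.
Qed.

HB.instance Definition _ := isIdealr.Build laurent torus_ideal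
  torus_ideal_closed.

Definition torus_ring : Type := {ideal_quot torus_ideal}.

HB.instance Definition _ := GRing.ComNzRing.copy torus_ring
  {ideal_quot torus_ideal}.

Definition torus_pi (r : laurent) : torus_ring := \pi_{ideal_quot torus_ideal} r.

HB.instance Definition _ := GRing.RMorphism.copy torus_pi
  (\pi_{ideal_quot torus_ideal} : laurent -> _).

Lemma torus_pi_surj (r : torus_ring) : exists f, r = torus_pi f.
Proof. by exists (repr r); rewrite /torus_pi reprK. Qed.

Definition torus_scale (c : K) (r : torus_ring) : torus_ring :=
  torus_pi c%:A * r.

Lemma torus_scaleA c d r :
  torus_scale c (torus_scale d r) = torus_scale (c * d) r.
Proof.
have E : (c * d)%:A = c%:A * d%:A :> laurent := rmorphM (in_alg laurent) c d.
by rewrite /torus_scale mulrA E (rmorphM torus_pi).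
Qed.

Lemma torus_scale1 : left_id 1 torus_scale.
Proof. by move=> r; rewrite /torus_scale scale1r (rmorph1 torus_pi) mul1r. Qed.

Lemma torus_scaleDr : right_distributive torus_scale +%R.
Proof. by move=> c r s; rewrite /torus_scale mulrDr. Qed.

Lemma torus_scaleDl r : {morph torus_scale^~ r : c d / c + d}.
Proof. by move=> c d; rewrite /torus_scale scalerDl (raddfD torus_pi) mulrDl. Qed.

HB.instance Definition _ := GRing.Zmodule_isLmodule.Build K torus_ring
  torus_scaleA torus_scale1 torus_scaleDr torus_scaleDl.

Lemma torus_scaleAl c (r s : torus_ring) : c *: (r * s) = (c *: r) * s.
Proof. exact: mulrA. Qed.

HB.instance Definition _ := GRing.Lmodule_isLalgebra.Build K torus_ring
  torus_scaleAl.
HB.instance Definition _ := GRing.Lalgebra_isComAlgebra.Build K torus_ring.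

Lemma torus_pi_scalable : scalable torus_pi.
Proof.
move=> c r; rewrite -[in LHS](mul1r r) (scalerAl c 1 r).
exact: (rmorphM torus_pi).
Qed.

HB.instance Definition _ :=
  GRing.isScalable.Build K laurent torus_ring *:%R torus_pi torus_pi_scalable.

End Torus.

(* ker D1 / im D2 for A^p --D2--> A^n --D1--> A^m, acting on column vectors. *)
Section Homology.
Variables (K : fieldType) (A : comAlgType K) (m n p : nat).
Variables (D1 : 'M[A]_(m, n)) (D2 : 'M[A]_(n, p)).

Definition cycle_pred : {pred 'cV[A]_n} := fun v => D1 *m v == 0.

Lemma cycle_submod : submod_closed cycle_pred.
Proof.
split=> [|c u v /eqP Du /eqP Dv]; rewrite unfold_in ?mulmx0 //.
by rewrite mulmxDr -scalemxAr Du Dv scaler0 addr0.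
Qed.

HB.instance Definition _ := GRing.isSubmodClosed.Build A 'cV[A]_n cycle_pred
  cycle_submod.

Record cycle : predArgType :=
  Cycle { cycle_val : 'cV[A]_n; _ : cycle_val \in cycle_pred }.

HB.instance Definition _ := [isSub for cycle_val].
HB.instance Definition _ := [Choice of cycle by <:].
HB.instance Definition _ := [SubChoice_isSubLmodule of cycle by <:].

Definition boundary_pred : {pred cycle} := fun z =>
  `[< exists w : 'cV[A]_p, val z = D2 *m w >].

Lemma boundary_zmod : zmod_closed boundary_pred.
Proof.
split=> [|y z /asboolP [u yE] /asboolP [v zE]]; apply/asboolP.
  by exists 0; rewrite mulmx0 raddf0.
by exists (u - v); rewrite raddfB /= mulmxBr -yE -zE.
Qed.

HB.instance Definition _ := GRing.isZmodClosed.Build cycle boundary_pred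
  boundary_zmod.

Definition homology : Type := Quotient.quot boundary_pred.

HB.instance Definition _ := GRing.Zmodule.copy homology (Quotient.quot boundary_pred).

Definition hclass (z : cycle) : homology := \pi_(Quotient.quot boundary_pred) z.

HB.instance Definition _ := GRing.Additive.copy hclass
  (\pi_(Quotient.quot boundary_pred) : cycle -> _).

Lemma hclass_eq0 z : (hclass z == 0) = (z \in boundary_pred).
Proof. by rewrite -[z in RHS]subr0 Quotient.idealrBE -[0 in LHS](raddf0 hclass). Qed.

Lemma hclass_surj h : exists z, h = hclass z.
Proof. by exists (repr h); rewrite /hclass reprK. Qed.

Definition hscale (c : K) (h : homology) : homology :=
  hclass (c%:A *: repr h).

Lemma hscaleE c z : hscale c (hclass z) = hclass (c%:A *: z).
Proof.
apply/eqP; rewrite -subr_eq0 -raddfB hclass_eq0 -scalerBr.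
have : repr (hclass z) - z \in boundary_pred.
  by rewrite -hclass_eq0 raddfB /= {1}/hclass reprK subrr.
move=> /asboolP [w zw]; apply/asboolP; exists (c%:A *: w).
by rewrite -scalemxAr -zw linearZ.
Qed.

Lemma hscaleA c d h : hscale c (hscale d h) = hscale (c * d) h.
Proof.
have [z ->] := hclass_surj h; rewrite !hscaleE scalerA.
by rewrite -scalerAl mul1r scalerA.
Qed.

Lemma hscale1 : left_id 1 hscale.
Proof.
by move=> h; have [z ->] := hclass_surj h; rewrite hscaleE !scale1r.
Qed.

Lemma hscaleDr : right_distributive hscale +%R.
Proof.
move=> c h1 h2; have [y ->] := hclass_surj h1; have [z ->] := hclass_surj h2.
by rewrite -raddfD !hscaleE scalerDr raddfD.
Qed.

Lemma hscaleDl h : {morph hscale^~ h : c d / c + d}.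
Proof.
move=> c d; have [z ->] := hclass_surj h.
by rewrite !hscaleE !scalerDl raddfD.
Qed.

HB.instance Definition _ := GRing.Zmodule_isLmodule.Build K homology
  hscaleA hscale1 hscaleDr hscaleDl.

End Homology.

Section FiniteSpan.
Variables (K : fieldType) (V : lmodType K).

Definition spanned_by n (b : 'I_n -> V) :=
  forall v, exists c : 'I_n -> K, v = \sum_i c i *: b i.

Lemma spanned_vector n (b : 'I_n -> V) :
  spanned_by b -> {d : nat & Vector.axiom d V}.
Proof.
move=> bV.
have exP : exists d, `[< exists b : 'I_d -> V, spanned_by b >].
  by exists n; apply/asboolP; exists b.
have [d /asboolP /cid [e eV] dmin] := ex_minnP exP.
have free_e (c : 'I_d -> K) : \sum_i c i *: e i = 0 -> forall i, c i = 0.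
  move=> c0 k; apply/eqP/negP => /negP ck.
  case: d => [|d] in e eV dmin c c0 k ck *; first by case: k ck.
  have/dmin : `[< exists b : 'I_d -> V, spanned_by b >]; last by rewrite ltnn.
  apply/asboolP; exists (fun j => e (lift k j)) => v.
  have [f fE] := eV v.
  exists (fun j => f (lift k j) - f k / c k * c (lift k j)).
  have -> : v = \sum_i (f i - f k / c k * c i) *: e i.
    under eq_bigr do rewrite scalerBl -scalerA.
    by rewrite sumrB -scaler_sumr c0 scaler0 subr0.
  by rewrite (bigD1_ord k) //= divfK // subrr scale0r add0r.
have [co coE] := choice eV.
have co_uniq (c : 'I_d -> K) i : co (\sum_i c i *: e i) i = c i.
  apply/eqP; rewrite -subr_eq0; apply/eqP.
  apply: (free_e (fun i => co (\sum_i c i *: e i) i - c i)).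
  under eq_bigr do rewrite scalerBl.
  by rewrite sumrB -coE subrr.
exists d; exists (fun v => \row_i co v i) => [a u v|].
  apply/rowP => i; rewrite !mxE {1}(coE u) {1}(coE v) scaler_sumr -big_split /=.
  under eq_bigr do rewrite scalerA -scalerDl.
  by rewrite (co_uniq (fun i => a * co u i + co v i)).
exists (fun r : 'rV_d => \sum_i r 0 i *: e i) => [v|r].
  by rewrite [RHS]coE; apply: eq_bigr => i _; rewrite mxE.
by apply/rowP => i; rewrite mxE (co_uniq (fun i => r 0 i)).
Qed.

Lemma finite_vector (T : finType) (g : T -> V) :
  (forall v, exists t, v = g t) -> {d : nat & Vector.axiom d V}.
Proof.
move=> gV; apply: (@spanned_vector #|T| (g \o enum_val)) => v.
have [t ->] := gV v; exists (fun i => (i == enum_rank t)%:R).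
rewrite (bigD1 (enum_rank t)) //= eqxx scale1r enum_rankK big1 ?addr0 //.
by move=> i /negPf ->; rewrite scale0r.
Qed.

End FiniteSpan.

Definition torus_box (L : 'I_3 -> nat) : nat := (\max_i L i)%N.

Section TorusFinite.
Variables (K : finFieldType) (L : 'I_3 -> nat).
Hypothesis L_gt0 : forall i, (0 < L i)%N.
Local Notation tpi := (@torus_pi K L).

Lemma torus_pi_xvarX i : tpi (xvar K i ^+ L i) = 1.
Proof.
apply/eqP; rewrite -subr_eq0 -(rmorph1 tpi) -raddfB /torus_pi -(raddf0 tpi).
rewrite -Quotient.idealrBE subr0; apply/asboolP.
exists (fun j => (j == i)%:R); rewrite (bigD1 i) //= eqxx mul1r big1 ?addr0 //.
by move=> j /negPf ->; rewrite mul0r.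
Qed.

Lemma torus_pi_period (i : 'I_3) (z : int) :
  tpi (gmon K (delta_mx 0 i *~ (z * (L i)%:Z))) = 1.
Proof.
have H (n : nat) : tpi (gmon K (delta_mx 0 i *+ (L i * n))) = 1.
  by rewrite -gmonX exprM (rmorphXn tpi) [Y in Y ^+ _]torus_pi_xvarX expr1n.
case: z => n.
  by rewrite -PoszM mulnC -pmulrn H.
rewrite NegzE mulNr mulrNz -PoszM mulnC -pmulrn.
set v := delta_mx 0 i *+ _.
have : tpi (gmon K (- v)) * tpi (gmon K v) = 1.
  by rewrite -(rmorphM tpi) -gmonD addNr; exact: (rmorph1 tpi).
by rewrite H mulr1.
Qed.

Local Notation N := (torus_box L).

Definition torus_exp (b : {ffun 'I_3 -> 'I_N.+1}) : 'rV[int]_3 :=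
  \row_i (b i : nat)%:Z.

Lemma torus_pi_gmon k : exists b, tpi (gmon K k) = tpi (gmon K (torus_exp b)).
Proof.
pose b := [ffun i => inord `|(k 0%R i %% (L i)%:Z)%Z|%N] : {ffun 'I_3 -> 'I_N.+1}.
have L0 i : (L i)%:Z != 0 by rewrite -lt0n.
exists b.
have -> : k = torus_exp b
    + \sum_i delta_mx 0 i *~ ((k 0%R i %/ (L i)%:Z)%Z * (L i)%:Z).
  apply/rowP => i; rewrite !mxE summxE (bigD1 i) //= big1 => [|j ji].
    rewrite ffunE inordK; last first.
      rewrite ltnS; apply: leq_trans (leq_bigmax i); rewrite ltnW // -ltz_nat.
      by rewrite gez0_abs ?modz_ge0 // ltz_pmod // ltz_nat.
    rewrite gez0_abs ?modz_ge0 // addr0 -scaler_int !mxE !eqxx mulr1 intz addrC.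
    exact: divz_eq.
  by rewrite -scaler_int !mxE eq_sym (negPf ji) andbF mulr0.
rewrite gmonD (rmorphM tpi) !big_ord_recl big_ord0 addr0 !gmonD.
by rewrite !(rmorphM tpi) /= !torus_pi_period !mulr1.
Qed.

Definition torus_enum (t : {ffun {ffun 'I_3 -> 'I_N.+1} -> K}) : torus_ring K L :=
  \sum_b t b *: tpi (gmon K (torus_exp b)).

Lemma torus_enum_surj r : exists t, r = torus_enum t.
Proof.
have [f ->] := torus_pi_surj r.
rewrite (galgE f) raddf_sum; elim/big_ind: _ => [|_ _ [s ->] [t ->]|k _].
- exists 0; rewrite /torus_enum big1 // => b _.
  by rewrite ffunE scale0r.
- exists (s + t); rewrite /torus_enum -big_split /=.
  by apply: eq_bigr => b _; rewrite ffunE scalerDl.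
- have [b kb] := torus_pi_gmon k.
  exists [ffun b' => f@_k *+ (b' == b)].
  rewrite /torus_enum (bigD1 b) //= ffunE eqxx mulr1n big1 ?addr0.
    by rewrite linearZ /= kb.
  by move=> b' /negPf b'b; rewrite ffunE b'b mulr0n scale0r.
Qed.

Lemma homology_torus_vector m n p (D1 : 'M[torus_ring K L]_(m, n))
    (D2 : 'M[torus_ring K L]_(n, p)) :
  {d : nat & Vector.axiom d (homology D1 D2)}.
Proof.
pose g (t : {ffun 'I_n -> {ffun {ffun 'I_3 -> 'I_N.+1} -> K}}) : homology D1 D2 :=
  hclass D2 (insubd 0 (\col_i torus_enum (t i))).
apply: (@finite_vector _ _ _ g) => h.
have [z ->] := hclass_surj h.
have [t tE] := choice (fun i => torus_enum_surj (val z i 0)).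
exists [ffun i => t i]; congr (hclass _ _).
rewrite (_ : \col_i _ = val z) ?valKd //.
by apply/colP => i; rewrite mxE ffunE -tE.
Qed.

End TorusFinite.

Definition mx_of_seqs (R : nzRingType) m n (s : seq (seq R)) : 'M[R]_(m, n) :=
  \matrix_(i, j) (nth [::] s i)`_j.

Section Koszul.
Variable K : fieldType.
Local Notation R := (laurent K).

Definition koszul_f (i : 'I_3) : R := xvar K i - 1.
Local Notation f := koszul_f.

Definition koszul1 : 'M[R]_(1, 3) :=
  mx_of_seqs 1 3 [:: [:: f 0 ; f 1 ; f 2 ] ].

Definition koszul2 : 'M[R]_(3, 3) :=
  mx_of_seqs 3 3 [:: [:: 0     ; f 2   ; - f 1 ];
                     [:: - f 2 ; 0     ; f 0   ];
                     [:: f 1   ; - f 0 ; 0     ] ].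

Definition koszul3 : 'M[R]_(3, 1) :=
  mx_of_seqs 3 1 [:: [:: f 0 ]; [:: f 1 ]; [:: f 2 ] ].

Variable a : 'cV[K]_3.

Definition coefR : 'cV[R]_3 := map_mx (in_alg R) a.

(* The differentials K_2 (+) K_3 -> K_1 (+) K_2 -> K_0 (+) K_1, acting on column
   vectors; css_D2 is the Z-stabilizer map, and the X-stabilizer map is the
   conjugate transpose of css_D1. *)
Definition css_D2 : 'M[R]_(3 + 3, 3 + 1) :=
  block_mx koszul2 coefR
           0       koszul3.

Definition css_D1 : 'M[R]_(1 + 3, 3 + 3) :=
  block_mx koszul1 (- coefR^T)
           0       koszul2.

Lemma css_complex : css_D1 *m css_D2 = 0.
Proof.
have simp := (mulr0, mul0r, addr0, add0r, mulrN, mulNr).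
have K12 : koszul1 *m koszul2 = 0.
  apply/matrixP => i j; rewrite !mxE !big_ord_recl big_ord0 !mxE !ord1.
  by case: j => [[|[|[|//]]] ?] /=; rewrite !simp mulrC ?subrr ?addNr.
have K23 : koszul2 *m koszul3 = 0.
  apply/matrixP => i j; rewrite !mxE !big_ord_recl big_ord0 !mxE !ord1.
  by case: i => [[|[|[|//]]] ?] /=; rewrite !simp mulrC ?subrr ?addNr.
have Ka : koszul1 *m coefR = coefR^T *m koszul3.
  apply/matrixP => i j; rewrite !mxE !big_ord_recl !big_ord0 !mxE !ord1 /=.
  by rewrite ![f _ * _]mulrC.
rewrite /css_D1 /css_D2 mulmx_block K12 K23 Ka !mulmx0 !mul0mx !mulNmx.
by rewrite !(subrr, addr0, add0r) block_mx0.
Qed.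

End Koszul.

(* Positivity of L plays no role in the quotient itself; it makes the space
   finite-dimensional, and the vectType instance below depends on it. *)
Definition HZ (a : 'cV['F_2]_3) (L : 'I_3 -> nat)
    (L_gt0 : forall i, (0 < L i)%N) : Type :=
  homology (map_mx (torus_pi L) (css_D1 a)) (map_mx (torus_pi L) (css_D2 a)).

HB.instance Definition _ a L (L_gt0 : forall i, (0 < L i)%N) :=
  GRing.Lmodule.copy (HZ a L_gt0) (homology (map_mx (torus_pi L) (css_D1 a))
                                            (map_mx (torus_pi L) (css_D2 a))).

HB.instance Definition _ a L (L_gt0 : forall i, (0 < L i)%N) :=
  Lmodule_hasFinDim.Build 'F_2 (HZ a L_gt0)
    (projT2 (homology_torus_vector L_gt0 (map_mx (torus_pi L) (css_D1 a))
                                         (map_mx (torus_pi L) (css_D2 a)))).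

Definition logical_qubits (a : 'cV['F_2]_3) (L : 'I_3 -> nat)
    (L_gt0 : forall i, (0 < L i)%N) : nat :=
  \dim {: HZ a L_gt0}.

Definition GSD (a : 'cV['F_2]_3) (L : 'I_3 -> nat)
    (L_gt0 : forall i, (0 < L i)%N) : nat :=
  (2 ^ logical_qubits a L_gt0)%N.

Definition rho (a : 'cV['F_2]_3) (L : 'I_3 -> nat) : nat :=
  if [&& a 0 0 * (L 1)%:R * (L 2)%:R == 0,
         a 1 0 * (L 2)%:R * (L 0)%:R == 0
       & a 2 0 * (L 0)%:R * (L 1)%:R == 0]
  then 0%N else 1%N.

(* Main.v *)
From HB Require Import structures.
From mathcomp Require Import all_boot all_order all_algebra finmap.
From mathcomp Require Import boolp monalg ring zify.
Require Import Defs.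

(* The complex is a segment of the mapping cone of the degree -2 chain map on
   the Koszul complex K of the f_i given by multiplication by a. Over the
   torus ring, K computes the homology of the 3-torus: H_1 has the basis N_i
   e_i ("lines"), H_2 the basis N_j N_k e_i ("planes") and H_3 the basis N_1
   N_2 N_3, where N_i = 1 + x_i + ... + x_i^(L_i - 1). Since N_i is
   homologous to L_i, the chain map sends the generator of H_3 to w = (a_1
   L_2 L_3, a_2 L_3 L_1, a_3 L_1 L_2) in H_1, and is the pairing with w from
   H_2 to H_0. The long exact sequence K --w--> H_1 -> H_Z -> H_2 --w^T--> K
   then gives dim H_Z = 6 - 2 [w <> 0]. *)

Set Implicit Arguments.
Unset Strict Implicit.
Unset Printing Implicit Defensive.

Import GRing.Theory.

Local Open Scope ring_scope.

(** * Case analysis and sums over three indices, and the abstract setting *)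

Lemma I3_ind (P : 'I_3 -> Prop) : P 0 -> P 1 -> P 2 -> forall i, P i.
Proof.
move=> P0 P1 P2 -[[|[|[|//]]] i3].
- by rewrite (_ : Ordinal i3 = 0) //; apply: val_inj.
- by rewrite (_ : Ordinal i3 = 1) //; apply: val_inj.
- by rewrite (_ : Ordinal i3 = 2) //; apply: val_inj.
Qed.

Lemma eq_colI3 (R : Type) (u v : 'cV[R]_3) :
  u 0 0 = v 0 0 -> u 1 0 = v 1 0 -> u 2 0 = v 2 0 -> u = v.
Proof. by move=> uv0 uv1 uv2; apply/colP; apply: I3_ind. Qed.

Lemma sum_I3 (V : nmodType) (F : 'I_3 -> V) : \sum_i F i = F 0 + F 1 + F 2.
Proof.
rewrite !big_ord_recl big_ord0 addr0 addrA; congr (_ + F _ + F _);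
  exact: val_inj.
Qed.

(* [e i] abstracts the specialization [x_i := 1] and [N i] the norm element
   [1 + x_i + ... + x_i^(L_i - 1)], with [l i] its image [L_i] in [K]. *)
Record koszul_retraction (K : fieldType) (A : comAlgType K) (f N : 'I_3 -> A)
    (l : 'I_3 -> K) (e : 'I_3 -> {lrmorphism A -> A}) : Prop :=
      KoszulRetraction {
  retr_f : forall i, e i (f i) = 0;
  retr_N : forall i, e i (N i) = (l i)%:A;
  retr_fix_f : forall i j, i != j -> e i (f j) = f j;
  retr_fix_N : forall i j, i != j -> e i (N j) = N j;
  retr_idem : forall i u, e i (e i u) = e i u;
  retr_comm : forall i j u, e i (e j u) = e j (e i u);
  retr_decomp : forall i u, exists h, u = e i u + f i * h;
  retr_const : forall u, exists c, e 0 (e 1 (e 2 u)) = c%:A;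
  norm_ann : forall i, f i * N i = 0;
  ann_norm : forall i u, f i * u = 0 -> exists r, u = N i * e i r;
  norm_inj : forall i u, N i * e i u = 0 -> e i u = 0
}.

(** * Koszul complexes with norm elements *)

Section Retraction.
Variables (K : fieldType) (A : comAlgType K) (f N : 'I_3 -> A).
Variables (l : 'I_3 -> K) (e : 'I_3 -> {lrmorphism A -> A}).
Hypothesis fNe : koszul_retraction f N l e.

Let ef i : e i (f i) = 0 := retr_f fNe i.
Let eN i : e i (N i) = (l i)%:A := retr_N fNe i.
Let eI i u : e i (e i u) = e i u := retr_idem fNe i u.
Let e_f : (e 0 (f 1) = f 1) * (e 0 (f 2) = f 2) * (e 1 (f 0) = f 0)
  * (e 1 (f 2) = f 2) * (e 2 (f 0) = f 0) * (e 2 (f 1) = f 1).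
Proof. by do !split; apply: (retr_fix_f fNe). Qed.
Let e_N : (e 0 (N 1) = N 1) * (e 0 (N 2) = N 2) * (e 1 (N 0) = N 0)
  * (e 1 (N 2) = N 2) * (e 2 (N 0) = N 0) * (e 2 (N 1) = N 1).
Proof. by do !split; apply: (retr_fix_N fNe). Qed.
Let e_A i c : e i c%:A = c%:A.
Proof. by rewrite linearZ rmorph1. Qed.
Let MA (x y : K) : (x * y)%:A = x%:A * y%:A :> A.
Proof. by rewrite mulr_algl scalerA. Qed.
Let eC i j u : e i (e j u) = e j (e i u) := retr_comm fNe i j u.

Lemma const_inj (c : K) : c%:A = 0 :> A -> c = 0.
Proof. by move/eqP; rewrite scaler_eq0 oner_eq0 orbF => /eqP. Qed.

Lemma norm_mul_inj i u : e i u = u -> N i * u = 0 -> u = 0.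
Proof. by move=> <-; apply: norm_inj fNe _ _. Qed.

(** Since [e j] is the specialization of x_j to 1, this models elements that do not involve the
    variables x_j with j in [s]. *)
Definition retr_fixed (s : seq 'I_3) (u : A) := forall j, j \in s -> e j u = u.

(** The quotient of [u] by [N i] provided by [ann_norm] can be chosen free of every variable that
    [u] is free of. Applying [e j] to u = N_i r fixes [u] and [N i], and commutation of the
    specializations keeps the properties already gained by [r]. *)
Lemma retr_fixed_norm s i u : retr_fixed s u -> i \notin s -> f i * u = 0 ->
  exists2 r, retr_fixed (i :: s) r & u = N i * r.
Proof.
move=> us Hs fu; elim: s us Hs => [|j s IHs] us.
  by case: (ann_norm fNe fu) => r -> _; exists (e i r) => // j;
    rewrite mem_seq1 => /eqP->.
rewrite inE negb_or => /andP[ij Hs].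
have [m ms|r rs uE] := IHs _ Hs; first by apply: us; rewrite inE ms orbT.
exists (e j r) => [m|].
  rewrite inE orbC inE -orbA => /or3P[/eqP-> //|ms|mi]; rewrite eC rs //.
  - by rewrite inE ms orbT.
  - by rewrite inE mi.
by rewrite -[LHS](us j) ?mem_head // uE rmorphM /= (retr_fix_N fNe) // eq_sym.
Qed.

(** Division by [f i] preserves freeness from other variables for the same reason: [e j] fixes
    [f i], so it may be applied to both remainder and quotient. *)
Lemma retr_fixed_decomp s i u : retr_fixed s u -> i \notin s ->
  exists2 r, retr_fixed (i :: s) r &
  exists2 h, retr_fixed s h & u = r + f i * h.
Proof.
elim: s => [|j s IHs] us.
  have [h uE] := retr_decomp fNe i u => _.
  by exists (e i u) => [j|]; [rewrite mem_seq1 => /eqP-> | exists h].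
rewrite inE negb_or => /andP[ij Hs].
have [m ms|r rs [h hs uE]] := IHs _ Hs; first by apply: us; rewrite inE ms orbT.
exists (e j r) => [m|].
  rewrite inE orbC inE -orbA => /or3P[/eqP-> //|ms|mi]; rewrite eC rs //.
  - by rewrite inE ms orbT.
  - by rewrite inE mi.
exists (e j h) => [m|].
  by rewrite inE => /orP[/eqP-> //|ms]; rewrite eC hs.
rewrite -[LHS](us j) ?mem_head // uE rmorphD rmorphM /= (retr_fix_f fNe) //.
by rewrite eq_sym.
Qed.

Lemma retr_fixed_const s u :
  retr_fixed s u -> (forall i, i \in s) -> exists c, u = c%:A.
Proof.
move=> us sT; have [c] := retr_const fNe u.
by rewrite !us //; exists c.
Qed.

(* Modulo boundaries, [p2] can be made free of x_0, x_1 and [p1] free of x_0;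
   then the terms [f i * p_i] vanish separately. *)
Lemma koszul_ker1 (p0 p1 p2 : A) : f 0 * p0 + f 1 * p1 + f 2 * p2 = 0 ->
  exists c0 c1 c2 : K, exists u0 u1 u2 : A,
  [/\ p0 = c0%:A * N 0 + (f 2 * u1 - f 1 * u2),
      p1 = c1%:A * N 1 + (f 0 * u2 - f 2 * u0) &
      p2 = c2%:A * N 2 + (f 1 * u0 - f 0 * u1)].
Proof.
move=> p_cyc.
have [||p2' p2'F [x _ p2E]] := @retr_fixed_decomp [::] 0 p2 => //.
have [//|t2 t2F [y _ p2'E]] := @retr_fixed_decomp _ 1 p2' p2'F.
have [||t1 t1F [z _ p1E]] := @retr_fixed_decomp [::] 0 (p1 + f 2 * y) => //.
(* [t0] absorbs the effect on the first entry of the boundaries used to normalize [p1] and [p2], so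
   (t0, t1, t2) is again a cycle. *)
pose t0 := p0 + f 2 * x + f 1 * z.
have t_cyc : f 0 * t0 + f 1 * t1 + f 2 * t2 = 0.
  rewrite -p_cyc /t0; have -> : t1 = p1 + f 2 * y - f 0 * z by rewrite p1E
    addrK.
  by rewrite p2E p2'E; ring.
have := congr1 (e 0) t_cyc.
rewrite !(rmorphD, rmorphM, rmorph0) /= ef mul0r add0r !e_f t1F ?t2F // => t12.
have := congr1 (e 1) t12.
rewrite !(rmorphD, rmorphM, rmorph0) /= ef mul0r add0r !e_f t2F // => ft2.
have ft1 : f 1 * t1 = 0 by rewrite -t12 ft2 addr0.
have ft0 : f 0 * t0 = 0 by rewrite -t_cyc ft1 ft2 !addr0.
have [//|r2 r2F t2E] := retr_fixed_norm t2F _ ft2.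
have [//|r1 r1F t1E] := retr_fixed_norm t1F _ ft1.
have [|||r0 r0F t0E] := @retr_fixed_norm [::] 0 t0 => //.
have [|c2 c2E] := retr_fixed_const r2F; first exact: I3_ind.
have [//|r1' r1'F [z1 _ r1E]] := @retr_fixed_decomp _ 2 _ r1F.
have [|c1 c1E] := retr_fixed_const r1'F; first exact: I3_ind.
have [//|r0' r0'F [z0 _ r0E]] := @retr_fixed_decomp _ 1 _ r0F.
have [//|r0'' r0''F [y0 _ r0'E]] := @retr_fixed_decomp _ 2 _ r0'F.
have [|c0 c0E] := retr_fixed_const r0''F; first exact: I3_ind.
(* [x], [y], [z] undo the normalization; [z0], [y0], [z1] come from reducing [r0] and [r1] to
   constants. The cross terms this creates vanish because f_i N_i = 0. *)
exists c0, c1, c2, (y - N 1 * z1), (N 0 * y0 - x), (z - N 0 * z0).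
have fN i u : f i * (N i * u) = 0 by rewrite mulrA (norm_ann fNe) mul0r.
split.
- have -> : p0 = t0 - f 2 * x - f 1 * z by rewrite /t0; ring.
  by rewrite t0E r0E r0'E c0E; ring.
- have -> : p1 = t1 + f 0 * z - f 2 * y by rewrite -p1E addrK.
  by rewrite t1E r1E c1E mulrBr fN; ring.
- by rewrite p2E p2'E t2E c2E !mulrBr !fN; ring.
Qed.

(** Subtracting a boundary makes the first entry free of x_0. Specializing x_0 to 1 shows that f_1
    and f_2 kill it, so it is a constant times N_1 N_2. Then f_0 kills the other two entries;
    cancelling N_0 from them leaves the analogous problem in the variables x_1, x_2. *)
Lemma koszul_ker2 (q0 q1 q2 : A) :
    f 0 * q1 = f 1 * q0 -> f 0 * q2 = f 2 * q0 -> f 1 * q2 = f 2 * q1 ->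
  exists c0 c1 c2 : K, exists v : A,
  [/\ q0 = c0%:A * (N 1 * N 2) + f 0 * v,
      q1 = c1%:A * (N 2 * N 0) + f 1 * v &
      q2 = c2%:A * (N 0 * N 1) + f 2 * v].
Proof.
move=> q01 q02 q12.
have [||s0 s0F [v1 _ q0E]] := @retr_fixed_decomp [::] 0 q0 => //.
pose s1 := q1 - f 1 * v1; pose s2 := q2 - f 2 * v1.
have s01 : f 0 * s1 = f 1 * s0.
  by rewrite /s1 mulrBr q01 q0E; ring.
have s02 : f 0 * s2 = f 2 * s0.
  by rewrite /s2 mulrBr q02 q0E; ring.
have s12 : f 1 * s2 = f 2 * s1.
  by rewrite /s1 /s2 mulrBr q12; ring.
have fs10 : f 1 * s0 = 0.
  by have := congr1 (e 0) s01; rewrite !rmorphM /= ef mul0r e_f s0F.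
have fs20 : f 2 * s0 = 0.
  by have := congr1 (e 0) s02; rewrite !rmorphM /= ef mul0r e_f s0F.
have [//|r0 r0F s0E] := retr_fixed_norm s0F _ fs10.
have fr0 : f 2 * r0 = 0.
  apply: (@norm_mul_inj 1); first by rewrite rmorphM /= e_f r0F.
  by rewrite mulrCA -s0E.
have [//|r0' r0'F r0E] := retr_fixed_norm r0F _ fr0.
have [|c0 c0E] := retr_fixed_const r0'F; first exact: I3_ind.
have [|||r1 r1F s1E] := @retr_fixed_norm [::] 0 s1 => //; first by rewrite s01.
have [|||r2 r2F s2E] := @retr_fixed_norm [::] 0 s2 => //; first by rewrite s02.
have r12 : f 1 * r2 = f 2 * r1.
  apply/eqP; rewrite -subr_eq0; apply/eqP/(@norm_mul_inj 0).
    by rewrite rmorphB !rmorphM /= !e_f r1F ?r2F.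
  by apply/eqP; rewrite mulrBr !(mulrCA (N 0)) -s1E -s2E s12 subrr.
have [//|r1' r1'F [v2 v2F r1E]] := @retr_fixed_decomp _ 1 _ r1F.
pose r2' := r2 - f 2 * v2.
have r2'F : retr_fixed [:: 0] r2'.
  by move=> j; rewrite mem_seq1 => /eqP->;
    rewrite rmorphB rmorphM /= e_f r2F ?v2F.
have r12' : f 1 * r2' = f 2 * r1'.
  by rewrite /r2' mulrBr r12 r1E; ring.
have fr1' : f 2 * r1' = 0.
  by have := congr1 (e 1) r12'; rewrite !rmorphM /= ef mul0r e_f r1'F.
have [//|t1 t1F r1'E] := retr_fixed_norm r1'F _ fr1'.
have [|c1 c1E] := retr_fixed_const t1F; first exact: I3_ind.
have [//||t2 t2F r2'E] := @retr_fixed_norm _ 1 _ r2'F; first by rewrite r12'.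
have [//|t2' t2'F [v3 _ t2E]] := @retr_fixed_decomp _ 2 _ t2F.
have [|c2 c2E] := retr_fixed_const t2'F; first exact: I3_ind.
have fN i u : f i * (N i * u) = 0 by rewrite mulrA (norm_ann fNe) mul0r.
(* The corrections [v1], [v2], [v3] come from the problems in three, two and one variables; each
   descent divides by one more norm, hence the nested factors. *)
exists c0, c1, c2, (v1 + N 0 * (v2 + N 1 * v3)); split.
- by rewrite q0E s0E r0E c0E mulrDr fN; ring.
- have -> : q1 = s1 + f 1 * v1 by rewrite /s1 subrK.
  rewrite s1E r1E r1'E c1E [N 0 * (v2 + _)]mulrDr !mulrDr.
  by rewrite [f 1 * (N 0 * (N 1 * _))]mulrCA fN; ring.
- have -> : q2 = s2 + f 2 * v1 by rewrite /s2 subrK.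
  have -> : s2 = N 0 * (r2' + f 2 * v2) by rewrite /r2' subrK.
  by rewrite r2'E t2E c2E; ring.
Qed.

(** Three successive divisions by norms: after each one, cancelling the norm shows that the
    remaining f_i still kill the quotient, which ends up free of all variables. *)
Lemma koszul_ker3 v : (forall i, f i * v = 0) ->
  exists c : K, v = c%:A * (N 0 * N 1 * N 2).
Proof.
move=> fv.
have [|||r0 r0F vE] := @retr_fixed_norm [::] 0 v => //.
have fr0 i : i != 0 -> f i * r0 = 0.
  move=> i0; apply: (@norm_mul_inj 0).
    by rewrite rmorphM /= (retr_fix_f fNe) 1?eq_sym // r0F.
  by rewrite mulrCA -vE.
have [//|r1 r1F r0E] := retr_fixed_norm r0F _ (fr0 1 isT).
have fr1 : f 2 * r1 = 0.
  apply: (@norm_mul_inj 1); first by rewrite rmorphM /= e_f r1F.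
  by rewrite mulrCA -r0E fr0.
have [//|r2 r2F r1E] := retr_fixed_norm r1F _ fr1.
have [|c cE] := retr_fixed_const r2F; first exact: I3_ind.
by exists c; rewrite vE r0E r1E cE; ring.
Qed.

Lemma koszul_coker u : e 0 (e 1 (e 2 u)) = 0 ->
  exists p0 p1 p2 : A, u = f 0 * p0 + f 1 * p1 + f 2 * p2.
Proof.
have [h2 E2] := retr_decomp fNe 2 u.
have [h1 E1] := retr_decomp fNe 1 (e 2 u).
have [h0 E0] := retr_decomp fNe 0 (e 1 (e 2 u)) => u0.
by exists h0, h1, h2; rewrite {1}E2 {1}E1 {1}E0 u0 add0r.
Qed.

(** Specializing x_j and x_k to 1 kills the right side and fixes c N_i; the norm then cancels. *)
Lemma koszul_ker1_uniq i j k (c : K) u v : uniq [:: i; j; k] ->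
  c%:A * N i = f j * u + f k * v -> c = 0.
Proof.
rewrite /= !inE !negb_or => /and3P[/andP[ij ik] jk _].
move=> /(congr1 (e j \o e k)) /=.
rewrite !(rmorphD, rmorphM) /= ef (retr_fix_f fNe (i:=k)) 1?eq_sym // ef.
rewrite (retr_fix_N fNe (i:=k)) 1?eq_sym // (retr_fix_N fNe (i:=j)) 1?eq_sym //.
by rewrite !e_A rmorph0 !mul0r addr0 mulrC => /norm_mul_inj; rewrite e_A =>
  /(_ erefl)/const_inj.
Qed.

(** Specializing x_i to 1 kills the right side only; both norms then cancel. *)
Lemma koszul_ker2_uniq i j k (c : K) v : uniq [:: i; j; k] ->
  c%:A * (N j * N k) = f i * v -> c = 0.
Proof.
rewrite /= !inE !negb_or => /and3P[/andP[ij ik] jk _].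
move=> /(congr1 (e i)) /=; rewrite !rmorphM /= ef mul0r
  !(retr_fix_N fNe (i:=i)) //.
rewrite e_A mulrCA => /norm_mul_inj.
rewrite !rmorphM /= e_A (retr_fix_N fNe) // => /(_ erefl).
by rewrite mulrC => /norm_mul_inj; rewrite e_A => /(_ erefl)/const_inj.
Qed.

(** * The twisted complex over an algebra with retractions *)

Definition mx_koszul1 : 'M[A]_(1, 3) :=
  mx_of_seqs 1 3 [:: [:: f 0 ; f 1 ; f 2 ] ].

Definition mx_koszul2 : 'M[A]_(3, 3) :=
  mx_of_seqs 3 3 [:: [:: 0     ; f 2   ; - f 1 ];
                     [:: - f 2 ; 0     ; f 0   ];
                     [:: f 1   ; - f 0 ; 0     ] ].

Definition mx_koszul3 : 'M[A]_(3, 1) :=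
  mx_of_seqs 3 1 [:: [:: f 0 ]; [:: f 1 ]; [:: f 2 ] ].

Definition col3 (R : nzRingType) (x y z : R) : 'cV[R]_3 :=
  \col_i [:: x; y; z]`_i.

Lemma mul_mx_koszul1 (p : 'cV[A]_3) :
  mx_koszul1 *m p = (f 0 * p 0 0 + f 1 * p 1 0 + f 2 * p 2 0)%:M.
Proof.
by apply/matrixP=> i j; rewrite !ord1 !mxE sum_I3 !mxE mulr1n.
Qed.

Lemma mul_mx_koszul2 (u : 'cV[A]_3) : mx_koszul2 *m u =
  col3 (f 2 * u 1 0 - f 1 * u 2 0) (f 0 * u 2 0 - f 2 * u 0 0)
       (f 1 * u 0 0 - f 0 * u 1 0).
Proof. by apply: eq_colI3; rewrite !mxE sum_I3 !mxE /=; ring. Qed.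

Lemma mul_mx_koszul3 (v : 'cV[A]_1) : mx_koszul3 *m v = \col_i (f i * v 0 0).
Proof. by apply: eq_colI3; rewrite !mxE big_ord1 !mxE. Qed.

Variable a : 'cV[K]_3.

Let aA : 'cV[A]_3 := map_mx (in_alg A) a.

Definition twisted_D1 : 'M[A]_(1 + 3, 3 + 3) :=
  block_mx mx_koszul1 (- aA^T) 0 mx_koszul2.

Definition twisted_D2 : 'M[A]_(3 + 3, 3 + 1) :=
  block_mx mx_koszul2 aA 0 mx_koszul3.

Lemma twisted_cycleP (p q : 'cV[A]_3) : reflect
  [/\ f 0 * p 0 0 + f 1 * p 1 0 + f 2 * p 2 0 =
        (a 0 0)%:A * q 0 0 + (a 1 0)%:A * q 1 0 + (a 2 0)%:A * q 2 0,
      f 0 * q 1 0 = f 1 * q 0 0,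
      f 0 * q 2 0 = f 2 * q 0 0 &
      f 1 * q 2 0 = f 2 * q 1 0]
  (col_mx p q \in cycle_pred twisted_D1).
Proof.
rewrite unfold_in mul_block_col mul_mx_koszul1 mul_mx_koszul2 mul0mx add0r.
rewrite mulNmx.
have -> : aA^T *m q =
    ((a 0 0)%:A * q 0 0 + (a 1 0)%:A * q 1 0 + (a 2 0)%:A * q 2 0)%:M.
  by apply/matrixP=> i j; rewrite !ord1 !mxE sum_I3 !mxE mulr1n.
rewrite col_mx_eq0 subr_eq0.
apply: (iffP andP) => [[/eqP/matrixP/(_ 0 0) + /eqP/colP q0]|[pE q01 q02 q12]].
  have := (q0 0, q0 1, q0 2); rewrite !mxE !mulr1n /= => -[[q0E q1E] q2E] pE.
  by split=> //; [have := q2E | have := q1E | have := q0E];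
    move/eqP; rewrite subr_eq0 => /eqP ->.
by split; [rewrite pE | apply/eqP/eq_colI3;
  rewrite !mxE /= ?q01 ?q02 ?q12 subrr].
Qed.

Lemma twisted_D2_mul (u : 'cV[A]_3) (v : 'cV[A]_1) : twisted_D2 *m col_mx u v =
  col_mx (mx_koszul2 *m u + v 0 0 *: aA) (\col_i (f i * v 0 0)).
Proof.
rewrite mul_block_col mul0mx add0r mul_mx_koszul3; congr (col_mx (_ + _) _).
by apply/colP => i; rewrite !mxE big_ord1 !mxE mulrC.
Qed.

Local Notation H := (homology twisted_D1 twisted_D2).

Lemma twisted_hclass_eq0 (p q : 'cV[A]_3)
    (zP : col_mx p q \in cycle_pred twisted_D1) :
  hclass twisted_D2 (Cycle zP) = 0 <->
  exists u v, p = mx_koszul2 *m u + v *: aA /\ q = \col_i (f i * v).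
Proof.
split=> [/eqP|[u [v [pE qE]]]].
  rewrite hclass_eq0 => /asboolP[w]; rewrite -[w]vsubmxK twisted_D2_mul /=.
  by move=> /eq_col_mx[-> ->]; exists (usubmx w), (dsubmx w 0 0).
apply/eqP; rewrite hclass_eq0; apply/asboolP; exists (col_mx u v%:M).
by rewrite twisted_D2_mul /= !mxE mulr1n -pE -qE.
Qed.

(** * Line and plane classes, and the maps of the exact sequence *)

Definition line_cycle (d : 'cV[K]_3) : 'cV[A]_3 := \col_i ((d i 0)%:A * N i).
Definition plane_cycle (c : 'cV[K]_3) : 'cV[A]_3 :=
  col3 ((c 0 0)%:A * (N 1 * N 2)) ((c 1 0)%:A * (N 2 * N 0))
       ((c 2 0)%:A * (N 0 * N 1)).
Definition twist_vec : 'cV[K]_3 :=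
  col3 (a 0 0 * l 1 * l 2) (a 1 0 * l 2 * l 0) (a 2 0 * l 0 * l 1).

Lemma line_cycle_linear (x : K) d d' :
  line_cycle (x *: d + d') = x%:A *: line_cycle d + line_cycle d'.
Proof. by apply/colP=> i; rewrite !mxE scalerDl -scalerA -mulr_algl; ring. Qed.

Lemma plane_cycle_linear (x : K) d d' :
  plane_cycle (x *: d + d') = x%:A *: plane_cycle d + plane_cycle d'.
Proof.
by apply: eq_colI3; rewrite !mxE /= scalerDl -scalerA -[x *: _]mulr_algl; ring.
Qed.

Lemma line_cycle_closed d : col_mx (line_cycle d) 0 \in cycle_pred twisted_D1.
Proof.
have fN i : f i * N i = 0 := norm_ann fNe i.
by apply/twisted_cycleP; split; rewrite !mxE ?mulr0 // !(mulrCA (f _)) !fN;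
  ring.
Qed.

Definition line_class d : H := hclass twisted_D2 (Cycle (line_cycle_closed d)).

Lemma line_class_linear : linear line_class.
Proof.
move=> x d d'; rewrite [x *: line_class _]hscaleE -raddfD; congr (hclass _ _).
apply: val_inj; rewrite /= line_cycle_linear.
by rewrite scale_col_mx add_col_mx scaler0 addr0.
Qed.

Lemma line_cycle_inj d d' u : line_cycle d = line_cycle d' + mx_koszul2 *m u ->
  d = d'.
Proof.
rewrite mul_mx_koszul2 => /colP E; have := (E 0, E 1, E 2).
rewrite !mxE /= => -[[E0 E1] E2].
apply/eqP; rewrite -subr_eq0; apply/eqP/eq_colI3; rewrite !mxE.
- apply: (@koszul_ker1_uniq 0 2 1 _ (u 1 0) (- u 2 0)) => //.
  by rewrite scalerBl mulrBl E0; ring.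
- apply: (@koszul_ker1_uniq 1 0 2 _ (u 2 0) (- u 0 0)) => //.
  by rewrite scalerBl mulrBl E1; ring.
- apply: (@koszul_ker1_uniq 2 1 0 _ (u 0 0) (- u 1 0)) => //.
  by rewrite scalerBl mulrBl E2; ring.
Qed.

Lemma plane_cycle_inj c c' v :
  plane_cycle c = plane_cycle c' + \col_i (f i * v) -> c = c'.
Proof.
move=> /colP E; have := (E 0, E 1, E 2).
rewrite !mxE /= => -[[E0 E1] E2].
apply/eqP; rewrite -subr_eq0; apply/eqP/eq_colI3; rewrite !mxE.
- apply: (@koszul_ker2_uniq 0 1 2 _ v) => //.
  by rewrite scalerBl mulrBl E0; ring.
- apply: (@koszul_ker2_uniq 1 2 0 _ v) => //.
  by rewrite scalerBl mulrBl E1; ring.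
- apply: (@koszul_ker2_uniq 2 0 1 _ v) => //.
  by rewrite scalerBl mulrBl E2; ring.
Qed.

Lemma koszul_cycle1 p : mx_koszul1 *m p = 0 ->
  exists d u, p = line_cycle d + mx_koszul2 *m u.
Proof.
rewrite mul_mx_koszul1 => /matrixP/(_ 0 0); rewrite !mxE mulr1n.
move=> /koszul_ker1[c0 [c1 [c2 [u0 [u1 [u2 [E0 E1 E2]]]]]]].
exists (col3 c0 c1 c2), (col3 u0 u1 u2); rewrite mul_mx_koszul2.
by apply: eq_colI3; rewrite !mxE.
Qed.

Let n3 : A := N 0 * N 1 * N 2.

Let fn3 i : f i * n3 = 0.
Proof.
have fN j : f j * N j = 0 := norm_ann fNe j.
rewrite /n3; elim/I3_ind: i; first by rewrite !mulrA fN !mul0r.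
  by rewrite [N 0 * _]mulrC !mulrA fN !mul0r.
by rewrite mulrCA fN mulr0.
Qed.

Let fn3M i u : f i * (n3 * u) = 0.
Proof. by rewrite mulrA fn3 mul0r. Qed.

(** Every f_i kills N_0 N_1 N_2, so this multiple of [a] is a Koszul cycle, homologous to some
    combination of lines. Specializing the two other variables to 1 in each coordinate removes the
    boundary and turns their norms into the scalars [l], which identifies the coefficients. *)
Lemma twist_norm : exists u, n3 *: aA = line_cycle twist_vec + mx_koszul2 *m u.
Proof.
have fN i : f i * N i = 0 := norm_ann fNe i.
have [|d [u E]] := @koszul_cycle1 (n3 *: aA).
  rewrite mul_mx_koszul1 !mxE !fn3M !addr0.
  by apply/matrixP => i j; rewrite !mxE mul0rn.
exists u; rewrite E; congr (line_cycle _ + _).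
move: E; rewrite mul_mx_koszul2 => /colP E; have := (E 0, E 1, E 2).
rewrite !mxE /= => -[[E0 E1] E2].
have Ninj i (x y : K) : x%:A * N i = y%:A * N i -> x = y.
  move=> xy; apply/eqP; rewrite -subr_eq0; apply/eqP.
  (* Addition in ['I_3] is modulo 3, so these are the three distinct indices. *)
  apply: (@koszul_ker1_uniq i (i + 1) (i + 2) _ 0 0).
    by case: i {xy} => -[|[|[|]]].
  by rewrite !mulr0 addr0 scalerBl mulrBl xy subrr.
apply: eq_colI3; rewrite !mxE /=.
- move/(congr1 (e 1 \o e 2)): E0 => /=.
  rewrite !(rmorphD, rmorphN, rmorphM) /= !(e_A, e_N, e_f, eN, ef, rmorph0).
  rewrite !mul0r subr0 addr0 => E0; apply: (Ninj 0); rewrite -E0 /=.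
  by rewrite !MA; ring.
- move/(congr1 (e 2 \o e 0)): E1 => /=.
  rewrite !(rmorphD, rmorphN, rmorphM) /= !(e_A, e_N, e_f, eN, ef, rmorph0).
  rewrite !mul0r subr0 addr0 => E1; apply: (Ninj 1); rewrite -E1 /=.
  by rewrite !MA; ring.
- move/(congr1 (e 0 \o e 1)): E2 => /=.
  rewrite !(rmorphD, rmorphN, rmorphM) /= !(e_A, e_N, e_f, eN, ef, rmorph0).
  rewrite !mul0r subr0 addr0 => E2; apply: (Ninj 2); rewrite -E2 /=.
  by rewrite !MA; ring.
Qed.

(** If a line cycle bounds, its zero K_2 component forces the K_3 part [v] of the bounding chain to
    be killed by all f_i, so [v] is a multiple of N_0 N_1 N_2. By [twist_norm] its contribution in
    K_1 is a multiple of [twist_vec] up to a Koszul boundary. *)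
Lemma line_class_eq0 d : line_class d = 0 <-> exists c, d = c *: twist_vec.
Proof.
have [w wE] := twist_norm.
rewrite twisted_hclass_eq0; split=> [[u [v [dE vE]]]|[c ->]].
  have [c cE] : exists c : K, v = c%:A * n3.
    by apply: koszul_ker3 => i; move/colP/(_ i): vE; rewrite !mxE.
  exists c; apply: (@line_cycle_inj _ _ (u + c%:A *: w)).
  have := line_cycle_linear c twist_vec 0; rewrite addr0 => ->.
  rewrite dE cE -scalerA wE scalerDr mulmxDr -scalemxAr.
  have -> : line_cycle 0 = 0 by apply/colP => i; rewrite !mxE scale0r mul0r.
  by rewrite addr0 addrCA.
exists (- (c%:A *: w)), (c%:A * n3); split; last first.
  by apply/colP => i; rewrite !mxE mulrCA fn3 mulr0.
have := line_cycle_linear c twist_vec 0; rewrite addr0 => ->.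
have -> : line_cycle 0 = 0 by apply/colP => i; rewrite !mxE scale0r mul0r.
rewrite addr0 -scalerA wE scalerDr mulmxN -scalemxAr.
by rewrite addrCA addNr addr0.
Qed.

Lemma twisted_cycle_decomp (z : cycle twisted_D1) :
  exists c v, dsubmx (val z) = plane_cycle c + \col_i (f i * v).
Proof.
case: z => z zP /=; have := zP; rewrite -[z]vsubmxK =>
  /twisted_cycleP[_ q01 q02 q12].
have [c0 [c1 [c2 [v [E0 E1 E2]]]]] := koszul_ker2 q01 q02 q12.
by exists (col3 c0 c1 c2), v; apply: eq_colI3;
  rewrite col_mxKd ?E0 ?E1 ?E2 !mxE.
Qed.

(** Setting all variables to 1 in the K_0 component of the cycle condition kills the f_i and leaves
    exactly the pairing of [c] with [twist_vec]. *)
Lemma twist_vec_orth c p q v : col_mx p q \in cycle_pred twisted_D1 ->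
  q = plane_cycle c + \col_i (f i * v) -> twist_vec^T *m c = 0.
Proof.
move=> /twisted_cycleP[/(congr1 (e 0 \o e 1 \o e 2)) /= E _ _ _] qE.
apply/matrixP => i j; rewrite !ord1 !mxE sum_I3 !mxE /=; apply: const_inj.
move: E; rewrite qE !mxE /=.
rewrite !(rmorphD, rmorphM) /= !(e_A, e_N, e_f, eN, ef, rmorph0).
rewrite !mul0r !addr0 => E.
have -> : a 0 0 * l 1 * l 2 * c 0 0 + a 1 0 * l 2 * l 0 * c 1 0
    + a 2 0 * l 0 * l 1 * c 2 0 = a 0 0 * (c 0 0 * (l 1 * l 2))
    + a 1 0 * (c 1 0 * (l 2 * l 0)) + a 2 0 * (c 2 0 * (l 0 * l 1)) by ring.
by rewrite !scalerDl !MA -E.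
Qed.

(** The pairing of [a] with the plane cycle specializes to w^T c = 0 when all variables are 1, so it
    lies in the ideal of the f_i; its coefficients there form [p]. *)
Lemma plane_cycle_lift c : twist_vec^T *m c = 0 ->
  exists p, col_mx p (plane_cycle c) \in cycle_pred twisted_D1.
Proof.
move=> wc.
have fN i : f i * N i = 0 := norm_ann fNe i.
have [|p0 [p1 [p2 pE]]] := @koszul_coker ((a 0 0)%:A * plane_cycle c 0 0
    + (a 1 0)%:A * plane_cycle c 1 0 + (a 2 0)%:A * plane_cycle c 2 0).
  rewrite !mxE /= !(rmorphD, rmorphM) /= !(e_A, e_N, e_f, eN, ef, rmorph0).
  rewrite -!MA -!scalerDl; move/matrixP/(_ 0 0): wc;
    rewrite !mxE sum_I3 !mxE /=.
  by move=> wc; rewrite -[RHS](scale0r 1) -wc; congr (_ *: _); ring.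
exists (col3 p0 p1 p2); apply/twisted_cycleP.
have fNl i u v : f i * (u * (N i * v)) = 0.
  by rewrite mulrCA [_ * (N i * v)]mulrA fN mul0r mulr0.
have fNr i u v : f i * (u * (v * N i)) = 0 by rewrite [v * _]mulrC fNl.
by split; rewrite ?pE !mxE //= !(fNl, fNr).
Qed.

(* [c] gives the coordinates of the K_2 component of [h] in H_2(K) = K^3. *)
Definition plane_class (h : H) (c : 'cV[K]_3) := exists z v,
  h = hclass twisted_D2 z /\ dsubmx (val z) = plane_cycle c + \col_i (f i * v).

Lemma plane_class_linear x h h' c c' : plane_class h c -> plane_class h' c' ->
  plane_class (x *: h + h') (x *: c + c').
Proof.
case=> [z [v [-> zE]]] [z' [v' [-> zE']]].
exists (x%:A *: z + z'), (x%:A * v + v'); split.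
  by rewrite [x *: _]hscaleE raddfD.
rewrite /= !linearD linearZ /= zE zE' plane_cycle_linear scalerDr addrACA;
  congr (_ + _).
by apply/colP => i; rewrite !mxE; ring.
Qed.

Lemma plane_class0 h c : plane_class h c -> h = 0 -> c = 0.
Proof.
case=> [[z zP] [v [-> /= zE]]]; move: zP zE; rewrite -[z]vsubmxK => zP.
rewrite col_mxKd => zE /twisted_hclass_eq0[u [v' [_ qE]]].
apply: (@plane_cycle_inj _ _ (v' - v)); rewrite (_ : plane_cycle 0 = 0).
  by rewrite -[LHS](addrK (\col_i (f i * v))) -zE qE; apply/colP=> i;
    rewrite !mxE; ring.
by apply: eq_colI3; rewrite !mxE /= scale0r mul0r.
Qed.

Lemma plane_class_uniq h c c' : plane_class h c -> plane_class h c' -> c = c'.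
Proof.
move=> hc hc'; have /plane_class0 := plane_class_linear (-1) hc' hc.
rewrite !scaleN1r addNr => /(_ erefl)/eqP.
by rewrite addrC subr_eq0 => /eqP.
Qed.

Lemma plane_class_exists h : exists c, plane_class h c.
Proof.
have [z ->] := hclass_surj h; have [c [v zE]] := twisted_cycle_decomp z.
by exists c, z, v.
Qed.

Lemma plane_class_image c : twist_vec^T *m c = 0 <-> exists h, plane_class h c.
Proof.
split=> [/plane_cycle_lift[p zP]|[h [[z zP] [v [_ /= zE]]]]].
  exists (hclass twisted_D2 (Cycle zP)), (Cycle zP), 0; split=> //=.
  by rewrite col_mxKd; apply/colP => i; rewrite !mxE mulr0 addr0.
by move: zP zE; rewrite -[z]vsubmxK col_mxKd; apply: twist_vec_orth.
Qed.

Lemma plane_class_ker h : plane_class h 0 <-> exists d, h = line_class d.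
Proof.
have n20 : plane_cycle 0 = 0 by apply: eq_colI3; rewrite !mxE /= scale0r mul0r.
split=> [[[z zP] [v [-> /=]]]|[d ->]]; last first.
  exists (Cycle (line_cycle_closed d)), 0; split=> //=.
  by rewrite col_mxKd n20 add0r; apply/colP => i; rewrite !mxE mulr0.
move: zP; rewrite -[z]vsubmxK col_mxKd n20 add0r;
  move: (usubmx z) (dsubmx z) => p q zP qE.
(* As q = (f_i v), subtracting the boundary of [v] clears the K_2 component and leaves a Koszul
   1-cycle, which is a line cycle up to boundary. *)
have p'_cyc : mx_koszul1 *m (p - v *: aA) = 0.
  have /twisted_cycleP[pE _ _ _] := zP; move: pE;
    rewrite qE mul_mx_koszul1 !mxE => pE.
  apply/matrixP=> i j; rewrite !ord1 !mxE mulr1n.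
  have -> : f 0 * (p 0 0 - v * (a 0 0)%:A) + f 1 * (p 1 0 - v * (a 1 0)%:A)
    + f 2 * (p 2 0 - v * (a 2 0)%:A) = f 0 * p 0 0 + f 1 * p 1 0 + f 2 * p 2 0
     - ((a 0 0)%:A * (f 0 * v) + (a 1 0)%:A * (f 1 * v) + (a 2 0)%:A * (f 2 *
       v)) by ring.
  by rewrite pE subrr.
have [d [u pE]] := koszul_cycle1 p'_cyc.
exists d; apply/eqP; rewrite -subr_eq0 -raddfB; apply/eqP.
have zP' : col_mx (p - line_cycle d) q \in cycle_pred twisted_D1.
  rewrite -[q]subr0 -[col_mx _ _]add_col_mx -opp_col_mx.
  exact: rpredB zP (line_cycle_closed d).
rewrite (_ : _ - _ = Cycle zP'); last first.
  by apply: val_inj; rewrite /= opp_col_mx add_col_mx subr0.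
apply/twisted_hclass_eq0; exists u, v; split=> //.
by rewrite -[p](subrK (v *: aA)) pE addrAC [line_cycle d + _]addrC addrK.
Qed.

(** [plane_class] is total and single-valued, so choice turns it into a function; uniqueness also
    makes that function linear. *)
Lemma twisted_exact :
  exists (s : {linear 'cV[K]_3 -> H}) (g : {linear H -> 'cV[K]_3}),
  [/\ forall d, s d = 0 <-> exists c, d = c *: twist_vec,
      forall h, g h = 0 <-> exists d, h = s d &
      forall c, twist_vec^T *m c = 0 <-> exists h, g h = c].
Proof.
have [g gP] := choice plane_class_exists.
have gE h c : g h = c <-> plane_class h c.
  by split=> [<- //|]; apply: plane_class_uniq.
have g_lin : linear g by move=> x h h'; apply/gE/plane_class_linear.
pose s' : {linear 'cV[K]_3 -> H} :=
  HB.pack line_class (GRing.isLinear.Build _ _ _ _ line_class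
    line_class_linear).
pose g' : {linear H -> 'cV[K]_3} :=
  HB.pack g (GRing.isLinear.Build _ _ _ _ g g_lin).
exists s', g'; split=> [|h|c]; first exact: line_class_eq0.
  by rewrite -plane_class_ker -gE.
by rewrite plane_class_image; split=> -[h /gE]; exists h.
Qed.

End Retraction.

(** * Dimension count from the exact sequence *)

(** Rank-nullity: the kernel of [g] is the image of [s], of dimension n - [w <> 0], and the image of
    [g] is the kernel of w^T, of the same dimension. *)
Lemma dim_exact (K : fieldType) (V : vectType K) (n : nat) (w : 'cV[K]_n)
    (s : {linear 'cV[K]_n -> V}) (g : {linear V -> 'cV[K]_n}) :
  (forall d, s d = 0 <-> exists c, d = c *: w) ->
  (forall h, g h = 0 <-> exists d, h = s d) ->
  (forall c, w^T *m c = 0 <-> exists h, g h = c) ->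
  \dim {:V} = (2 * n - 2 * (w != 0%R))%N.
Proof.
move=> kers kerg img.
have dimcV m : \dim {:'cV[K]_m} = m by rewrite dimvf /dim /= muln1.
have lker_s : lker (linfun s) = <[w]>%VS.
  apply/vspaceP => d; rewrite memv_ker lfunE /=.
  apply/eqP/idP => [/kers[c ->]|/vlineP[c ->]];
    first by rewrite memvZ ?memv_line.
  by apply/kers; exists c.
have lker_g : lker (linfun g) = limg (linfun s).
  apply/vspaceP => h; rewrite memv_ker lfunE /=.
  apply/eqP/memv_imgP => [/kerg[d ->]|[d _ ->]].
    by exists d; rewrite ?memvf ?lfunE.
  by apply/kerg; exists d; rewrite lfunE.
pose phi : 'Hom('cV[K]_n, 'cV[K]_1) := linfun (mulmx w^T).
have limg_g : limg (linfun g) = lker phi.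
  apply/vspaceP => c; rewrite memv_ker lfunE /=.
  apply/memv_imgP/eqP => [[h _ ->]|/img[h <-]].
    by apply/img; exists h; rewrite lfunE.
  by exists h; rewrite ?memvf ?lfunE.
have dims := limg_ker_dim (linfun s) fullv.
have dimg := limg_ker_dim (linfun g) fullv.
have dimp := limg_ker_dim phi fullv.
move: dims dimg dimp; rewrite !capfv lker_s lker_g limg_g dim_vline dimcV.
have -> : \dim (limg phi) = (w != 0).
  have [w0|w0] /= := eqVneq w 0.
    apply/eqP; rewrite dimv_eq0 -subv0; apply/subvP => x /memv_imgP[c _ ->].
    by rewrite lfunE /= w0 trmx0 mul0mx mem0v.
  rewrite -[RHS](dimcV 1); congr (\dim _); apply/eqP; rewrite eqEsubv subvf /=.
  (* A nonzero entry of [w] yields a preimage of any scalar under w^T, supported at that entry. *)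
  have [i wi] : exists i, w i 0 != 0.
    by apply/existsP; apply: contraNT w0; rewrite negb_exists => /forallP w0;
       apply/eqP/colP => i; rewrite mxE; apply/eqP; rewrite -[_ == _]negbK.
  apply/subvP => x _; apply/memv_imgP;
    exists (delta_mx i 0 *m ((w i 0)^-1 *: x)).
    exact: memvf.
  rewrite lfunE /= mulmxA -colE; apply/colP => j;
    rewrite !mxE big_ord1 !mxE !ord1.
  by rewrite mulrA divff // mul1r.
by case: (w != 0) => /=; lia.
Qed.

(** * The universal property of the torus ring *)

Section LinearExtension.
Variables (K : fieldType) (G : zmodType) (V : lmodType K) (phi : G -> V).

Definition galg_ext (g : galg K G) : V := \sum_(k <- msupp g) g@_k *: phi k.

Lemma galg_extw (d : {fset G}) (g : galg K G) : (msupp g `<=` d)%fset ->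
  galg_ext g = \sum_(k <- d) g@_k *: phi k.
Proof.
move=> le; rewrite /galg_ext (big_fset_incl _ le) // => k _ /mcoeff_outdom ->.
by rewrite scale0r.
Qed.

Lemma galg_ext_linear : linear galg_ext.
Proof.
move=> c g h; have le := msuppD_le (c *: g) h.
(* A common index set for the three sums; [msupp g] is included separately because scaling by 0
   shrinks the support. *)
pose d := (msupp g `|` (msupp (c *: g) `|` msupp h))%fset.
have led := fsubset_trans le (fsubsetUr (msupp g) _).
have leh : (msupp h `<=` d)%fset by rewrite /d fsetUA fsubsetUr.
rewrite (galg_extw led) (galg_extw leh) (@galg_extw d g) ?fsubsetUl //.
rewrite scaler_sumr -big_split /=; apply: eq_bigr => k _.
by rewrite mcoeffD [(c *: g)@_k]mcoeff_scale scalerDl scalerA.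
Qed.

HB.instance Definition _ :=
  GRing.isLinear.Build K (galg K G) V *:%R galg_ext galg_ext_linear.

Lemma galg_ext_gmon k : galg_ext (gmon K k) = phi k.
Proof.
rewrite (@galg_extw [fset k]%fset) ?big_seq_fset1 ?mcoeff_gmon ?eqxx ?scale1r
  //.
by rewrite gmon.unlock msuppU_le.
Qed.

End LinearExtension.

Section TorusMonomials.
Variables (K : finFieldType) (L : 'I_3 -> nat).
Local Notation A := (torus_ring K L).

Definition torus_mon (k : 'rV[int]_3) : A := torus_pi L (gmon K k).

Lemma torus_mon0 : torus_mon 0 = 1.
Proof. exact: (rmorph1 (@torus_pi K L)). Qed.

Lemma torus_monD k k' : torus_mon (k + k') = torus_mon k * torus_mon k'.
Proof. by rewrite /torus_mon gmonD rmorphM. Qed.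

Lemma torus_mon_period k i (z : int) :
  torus_mon (k + delta_mx 0 i *~ (z * (L i)%:Z)) = torus_mon k.
Proof. by rewrite torus_monD [Y in _ * Y]torus_pi_period mulr1. Qed.

Lemma torus_ind (P : A -> Prop) : P 0 ->
  (forall c k u, P u -> P (c *: torus_mon k + u)) -> forall u, P u.
Proof.
move=> P0 PD u; have [g ->] := torus_pi_surj u.
rewrite (galgE g) raddf_sum /=; elim: (enum_fset _) => [|k s IHs].
  by rewrite big_nil.
by rewrite big_cons linearZ; apply: PD.
Qed.

Lemma torus_linear_eq (V : lmodType K) (F G : {linear A -> V}) :
  (forall k, F (torus_mon k) = G (torus_mon k)) -> F =1 G.
Proof.
move=> FG; apply: torus_ind => [|c k u uE]; first by rewrite !linear0.
by rewrite !linearD !linearZ /= FG uE.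
Qed.

Section Lift.
Variables (V : lmodType K) (phi : 'rV[int]_3 -> V).

(** The value is taken on a chosen representative; under [phi_period] the choice does not matter. *)
Definition torus_lift (u : A) : V := galg_ext phi (repr u).

Hypothesis phi_period : forall k i, phi (k + delta_mx 0 i *+ L i) = phi k.

(** The ideal is spanned by monomial multiples of x_i^(L_i) - 1, and the linear extension of a
    periodic [phi] vanishes on each of them. *)
Lemma torus_lift_pi g : torus_lift (torus_pi L g) = galg_ext phi g.
Proof.
have : repr (torus_pi L g) - g \in torus_ideal L.
  by rewrite Quotient.idealrBE /torus_pi reprK.
move=> /asboolP[h hE]; apply/eqP; rewrite -subr_eq0 -raddfB /= hE raddf_sum.
rewrite big1 // => i _; rewrite mulrBr mulr1 raddfB /=; apply/eqP;
  rewrite subr_eq0.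
rewrite (galgE (h i)) mulr_suml !raddf_sum /=; apply/eqP/eq_bigr => k _.
by rewrite -scalerAl !linearZ gmonX -gmonD /= !galg_ext_gmon phi_period.
Qed.

Lemma torus_lift_mon k : torus_lift (torus_mon k) = phi k.
Proof. by rewrite torus_lift_pi galg_ext_gmon. Qed.

Lemma torus_lift_linear : linear torus_lift.
Proof.
move=> c u v; have [g ->] := torus_pi_surj u; have [h ->] := torus_pi_surj v.
by rewrite -linearP !torus_lift_pi linearP.
Qed.

End Lift.

(** * Specializations and norms in the torus ring *)

(** The effect on exponents of setting x_i to 1. *)
Definition drop_coord (i : 'I_3) (k : 'rV[int]_3) : 'rV[int]_3 :=
  \row_j if j == i then 0 else k 0 j.

Lemma drop_coordD i k k' :
  drop_coord i (k + k') = drop_coord i k + drop_coord i k'.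
Proof. by apply/rowP => j; rewrite !mxE; case: ifP; rewrite ?addr0. Qed.

Lemma drop_coordK i k : k = drop_coord i k + delta_mx 0 i *~ k 0 i.
Proof.
apply/rowP => j; rewrite -scaler_int !mxE eqxx /=.
by case: eqVneq => [->|]; rewrite ?mulr1 ?mulr0 ?add0r ?addr0 ?intz.
Qed.

Lemma drop_coord_idem i k : drop_coord i (drop_coord i k) = drop_coord i k.
Proof. by apply/rowP => j; rewrite !mxE; case: (j == i). Qed.

Lemma drop_coord_comm i j k :
  drop_coord i (drop_coord j k) = drop_coord j (drop_coord i k).
Proof. by apply/rowP => m; rewrite !mxE; case: (m == i); case: (m == j). Qed.

Lemma drop_coord_delta i j n :
  drop_coord i (delta_mx 0 j *+ n) = if i == j then 0 else delta_mx 0 j *+ n.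
Proof.
apply/rowP => m; rewrite
  (fun_if (fun M : 'rV[int]_3 => M 0 m)) !mxE !mulmxnE !mxE /=.
have [->|mi] := eqVneq m i; first by case: (i == j) => //=; rewrite mul0rn.
by have [ij|//] := eqVneq i j; rewrite -ij (negPf mi) mul0rn.
Qed.

Definition torus_retr i : A -> A := torus_lift (torus_mon \o drop_coord i).

Lemma torus_retr_period i k j :
  (torus_mon \o drop_coord i) (k + delta_mx 0 j *+ L j) =
  (torus_mon \o drop_coord i) k.
Proof.
rewrite /= drop_coordD drop_coord_delta; case: ifP => _; first by rewrite addr0.
by have := torus_mon_period (drop_coord i k) j 1; rewrite mul1r -pmulrn.
Qed.

Lemma torus_retr_mon i k :
  torus_retr i (torus_mon k) = torus_mon (drop_coord i k).
Proof. exact: torus_lift_mon (torus_retr_period i) k. Qed.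

HB.instance Definition _ i := GRing.isLinear.Build K A A *:%R (torus_retr i)
  (torus_lift_linear (torus_retr_period i)).

Lemma torus_retr_monoid i : monoid_morphism (torus_retr i).
Proof.
split=> [|u v].
  by rewrite -torus_mon0 torus_retr_mon; congr torus_mon; apply/rowP => j;
    rewrite !mxE if_same.
elim/torus_ind: u => [|c k u uE]; first by rewrite !(mul0r, linear0).
rewrite mulrDl !linearD mulrDl /= uE -scalerAl !linearZ -scalerAl /=;
  congr (_ *: _ + _).
elim/torus_ind: v {u uE} => [|d k' v vE]; first by rewrite !(mulr0, linear0).
rewrite mulrDr !linearD mulrDr /= vE -scalerAr !linearZ -scalerAr /=;
  congr (_ *: _ + _).
by rewrite -torus_monD !torus_retr_mon drop_coordD torus_monD.
Qed.

HB.instance Definition _ i := GRing.isMonoidMorphism.Build A A (torus_retr i)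
  (torus_retr_monoid i).

(** Selects the part of degree 0 in x_i modulo L_i. The resulting [torus_part] serves as a left
    inverse to multiplication by the norm on elements free of x_i. *)
Definition torus_part_fun i (k : 'rV[int]_3) : A :=
  if ((L i)%:Z %| k 0%R i)%Z then torus_mon k else 0.

Definition torus_part i : A -> A := torus_lift (torus_part_fun i).

Lemma torus_part_period i k j :
  torus_part_fun i (k + delta_mx 0 j *+ L j) = torus_part_fun i k.
Proof.
rewrite /torus_part_fun.
have -> : torus_mon (k + delta_mx 0 j *+ L j) = torus_mon k.
  by have := torus_mon_period k j 1; rewrite mul1r -pmulrn.
rewrite !mxE mulmxnE mxE /= rpredDr //.
by case: eqVneq => [<-|_]; rewrite ?mul0rn ?dvdz0 ?natz ?dvdzz.
Qed.

Lemma torus_part_mon i k : torus_part i (torus_mon k) =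
  if ((L i)%:Z %| k 0%R i)%Z then torus_mon k else 0.
Proof. exact: torus_lift_mon (torus_part_period i) k. Qed.

HB.instance Definition _ i := GRing.isLinear.Build K A A *:%R (torus_part i)
  (torus_lift_linear (torus_part_period i)).

Definition torus_f i : A := torus_pi L (koszul_f K i).
Definition torus_norm i : A := \sum_(m < L i) torus_mon (delta_mx 0 i *+ m).

Lemma torus_fE i : torus_f i = torus_mon (delta_mx 0 i) - 1.
Proof. by rewrite /torus_f /koszul_f rmorphB rmorph1. Qed.

Lemma torus_monX k n : torus_mon (k *+ n) = torus_mon k ^+ n.
Proof. by rewrite /torus_mon -gmonX rmorphXn. Qed.

Lemma torus_retr_part i u : torus_retr i (torus_part i u) = torus_part i u.
Proof.
apply: (torus_linear_eq (F := torus_retr i \o torus_part i)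
  (G := torus_part i)) => k /=.
rewrite torus_part_mon; case: ifP => [|_]; last by rewrite linear0.
move=> /dvdzP[z kz]; rewrite torus_retr_mon [in RHS](drop_coordK i k) kz.
by rewrite torus_mon_period.
Qed.

Lemma torus_normE i :
  torus_norm i = \sum_(m < L i) torus_mon (delta_mx 0 i) ^+ m.
Proof. by apply: eq_bigr => m _; rewrite torus_monX. Qed.

Lemma torus_f_norm i : torus_f i * torus_norm i = 0.
Proof.
rewrite torus_fE torus_normE -subrX1 -torus_monX.
have := torus_mon_period 0 i 1; rewrite mul1r -pmulrn add0r => ->.
by rewrite torus_mon0 subrr.
Qed.

Lemma torus_f_dvd i (z : int) :
  exists h, torus_mon (delta_mx 0 i *~ z) - 1 = torus_f i * h.
Proof.
case: z => n; first by rewrite -pmulrn torus_monX subrX1 -torus_fE; eexists.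
(* A negative power reduces to a positive one by x^(-n) - 1 = - x^(-n) (x^n - 1). *)
rewrite NegzE mulrNz -pmulrn; set y := torus_mon (- _).
exists (- y * \sum_(m < n.+1) torus_mon (delta_mx 0 i) ^+ m).
rewrite mulrCA torus_fE -subrX1 -torus_monX mulNr mulrBr mulr1 -torus_monD.
by rewrite addNr torus_mon0 opprB.
Qed.

Lemma torus_retr_decomp i u : exists h, u = torus_retr i u + torus_f i * h.
Proof.
elim/torus_ind: u => [|c k u [h uE]]; first by exists 0;
  rewrite linear0 mulr0 addr0.
have [y yE] := torus_f_dvd i (k 0 i).
exists (c *: (torus_mon (drop_coord i k) * y) + h).
rewrite linearP /= mulrDr addrACA -uE; congr (_ + _).
rewrite -scalerAr -scalerDr torus_retr_mon; congr (_ *: _).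
by rewrite mulrCA -yE mulrBr mulr1 -torus_monD -drop_coordK addrC subrK.
Qed.

Hypothesis L_gt0 : forall i, (0 < L i)%N.

(* [u] is split according to the residue mod L_i of the exponent of x_i. *)
Lemma torus_part_sum i u : u = \sum_(m < L i)
  torus_mon (delta_mx 0 i *+ m) *
  torus_part i (torus_mon (- (delta_mx 0 i *+ m)) * u).
Proof.
elim/torus_ind: u => [|c k u uE].
  by rewrite big1 // => m _; rewrite mulr0 linear0 mulr0.
rewrite [in LHS]uE; under [RHS]eq_bigr do
  rewrite mulrDr linearD mulrDr -scalerAr linearZ -scalerAr /=.
rewrite big_split /= -scaler_sumr; congr (_ *: _ + _).
have L0 : (L i)%:Z != 0 by rewrite -lt0n.
have rlt : (`|(k 0%R i %% (L i)%:Z)%Z| < L i)%N.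
  by rewrite -ltz_nat gez0_abs ?modz_ge0 // ltz_pmod // ltz_nat.
have partE (m : 'I_(L i)) : torus_part i (torus_mon (- (delta_mx 0 i *+ m)) *
  torus_mon k)
    = if m == Ordinal rlt then torus_mon (- (delta_mx 0 i *+ m)) * torus_mon k
      else 0.
  rewrite -torus_monD torus_part_mon !mxE mulmxnE mxE !eqxx /= natz addrC.
  rewrite -eqz_mod_dvd -val_eqE /= [in RHS]eq_sym -eqz_nat gez0_abs ?modz_ge0
    //.
  by rewrite [(m%:Z %% _)%Z]modz_small // ltz_nat ltn_ord.
under eq_bigr do rewrite partE.
rewrite (bigD1 (Ordinal rlt)) //= eqxx big1 ?addr0 => [|m /negPf->];
  last by rewrite mulr0.
by rewrite mulrA -torus_monD subrr torus_mon0 mul1r.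
Qed.

(** The hypothesis says x_i u = u, so all residue parts of [u] coincide and the sum of
    [torus_part_sum] factors through the norm. *)
Lemma torus_ann_norm i u :
  torus_f i * u = 0 -> exists r, u = torus_norm i * torus_retr i r.
Proof.
rewrite torus_fE mulrBl mul1r => /eqP; rewrite subr_eq0 => /eqP xu.
have xVu m : torus_mon (- (delta_mx 0 i *+ m)) * u = u.
  rewrite -[X in _ * X = _](_ : torus_mon (delta_mx 0 i *+ m) * u = u).
    by rewrite mulrA -torus_monD addNr torus_mon0 mul1r.
  elim: m => [|m IHm]; first by rewrite mulr0n torus_mon0 mul1r.
  by rewrite mulrS torus_monD -mulrA IHm.
exists (torus_part i u); rewrite torus_retr_part [LHS](torus_part_sum i)
  mulr_suml.
by apply: eq_bigr => m _; rewrite xVu.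
Qed.

(** Among the terms x_i^m of the norm with 0 <= m < L_i, only m = 0 has exponent divisible by L_i;
    positivity of L_i ensures that this term exists. *)
Lemma torus_part_norm i u :
  torus_part i (torus_norm i * torus_retr i u) = torus_retr i u.
Proof.
elim/torus_ind: u => [|c k u uE]; first by rewrite linear0 mulr0 linear0.
rewrite linearP mulrDr linearD /= uE -scalerAr linearZ; congr (_ *: _ + _).
rewrite torus_retr_mon mulr_suml linear_sum /=.
rewrite (bigD1 (Ordinal (L_gt0 i))) //= big1 => [|m].
  by rewrite mulr0n torus_mon0 mul1r torus_part_mon !mxE eqxx dvdz0 addr0.
rewrite -val_eqE /= -torus_monD torus_part_mon !mxE mulmxnE mxE !eqxx /= addr0
  [_ *+ m]natz => m0.
by rewrite dvdzE gtnNdvd ?lt0n // !absz_nat ltn_ord.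
Qed.

Lemma torus_norm_inj i u :
  torus_norm i * torus_retr i u = 0 -> torus_retr i u = 0.
Proof. by move=> Nu; rewrite -torus_part_norm Nu linear0. Qed.

Lemma torus_retraction :
  koszul_retraction torus_f torus_norm (fun i => (L i)%:R) torus_retr.
Proof.
have retr_delta i j n : torus_retr i (torus_mon (delta_mx 0 j *+ n))
    = if i == j then 1 else torus_mon (delta_mx 0 j *+ n).
  by rewrite torus_retr_mon drop_coord_delta; case: ifP => //;
    rewrite torus_mon0.
have retr_f i j : torus_retr i (torus_f j) = if i == j then 0 else torus_f j.
  rewrite torus_fE rmorphB rmorph1 -[delta_mx _ _]mulr1n /= retr_delta.
  by case: ifP; rewrite ?subrr.
split.
- by move=> i /=; rewrite retr_f eqxx.
- move=> i /=; rewrite linear_sum /=.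
  under eq_bigr do rewrite retr_delta eqxx.
  by rewrite sumr_const card_ord scaler_nat.
- by move=> i j /negPf ij /=; rewrite retr_f ij.
- move=> i j /negPf ij /=; rewrite linear_sum /=.
  by apply: eq_bigr => m _; rewrite retr_delta ij.
- move=> i u /=.
  apply: (torus_linear_eq (F := torus_retr i \o torus_retr i)
    (G := torus_retr i)) => k /=.
  by rewrite !torus_retr_mon drop_coord_idem.
- move=> i j u /=.
  apply: (torus_linear_eq (F := torus_retr i \o torus_retr j)
    (G := torus_retr j \o torus_retr i)) => k /=.
  by rewrite !torus_retr_mon drop_coord_comm.
- exact: torus_retr_decomp.
- elim/torus_ind => [|c k u [d uE]]; first by exists 0;
  rewrite !linear0 scale0r.
  exists (c + d); rewrite !linearP /= uE !torus_retr_mon scalerDl;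
    congr (_ *: _ + _).
  by rewrite -torus_mon0; congr torus_mon; apply/rowP; apply: I3_ind;
    rewrite !mxE.
- exact: torus_f_norm.
- exact: torus_ann_norm.
- exact: torus_norm_inj.
Qed.

End TorusMonomials.

(** * The model on the torus as a twisted complex *)

Lemma torus_pi_alg (K : fieldType) (L : 'I_3 -> nat) (c : K) :
  torus_pi L c%:A = c%:A.
Proof. by rewrite linearZ /= (rmorph1 (@torus_pi K L)). Qed.

Lemma map_css_D1 (K : finFieldType) (L : 'I_3 -> nat) (a : 'cV[K]_3) :
  map_mx (torus_pi L) (css_D1 a) = twisted_D1 (@torus_f K L) a.
Proof.
rewrite /css_D1 map_block_mx map_mxN map_mx0; congr block_mx.
- apply/matrixP => i j; rewrite !mxE; elim/I3_ind: j; by rewrite ord1.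
- by apply/matrixP => i j; rewrite !mxE /= torus_pi_alg.
- apply/matrixP; apply: I3_ind; apply: I3_ind;
  by rewrite !mxE /= ?rmorphN ?rmorph0.
Qed.

Lemma map_css_D2 (K : finFieldType) (L : 'I_3 -> nat) (a : 'cV[K]_3) :
  map_mx (torus_pi L) (css_D2 a) = twisted_D2 (@torus_f K L) a.
Proof.
rewrite /css_D2 map_block_mx map_mx0; congr block_mx.
- apply/matrixP; apply: I3_ind; apply: I3_ind;
  by rewrite !mxE /= ?rmorphN ?rmorph0.
- by apply/matrixP => i j; rewrite !mxE /= torus_pi_alg.
- apply/matrixP => i j; rewrite !mxE; elim/I3_ind: i; by rewrite ord1.
Qed.

Lemma rho_twist_vec (a : 'cV['F_2]_3) L :
  rho a L = (twist_vec (fun i => (L i)%:R) a != 0) :> nat.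
Proof.
rewrite /rho; case: ifPn => [/and3P[/eqP w0 /eqP w1 /eqP w2]|].
  by rewrite (_ : twist_vec _ a = 0) ?eqxx //; apply: eq_colI3; rewrite !mxE.
move=> nw; suff -> : twist_vec (fun i => (L i)%:R) a != 0 by [].
apply: contraNneq nw => /colP w0; have := (w0 0, w0 1, w0 2).
by rewrite !mxE /= => -[[-> ->] ->]; rewrite eqxx.
Qed.

Local Close Scope ring_scope.

(* trunc_log 2 is exact here, since GSD is a power of 2. *)
Theorem fact11 (a : 'cV['F_2]_3) (L : 'I_3 -> nat)
    (L_gt0 : forall i, (0 < L i)%N) :
  logical_qubits a L_gt0 = trunc_log 2 (GSD a L_gt0) /\
  trunc_log 2 (GSD a L_gt0) = (6 - 2 * rho a L)%N.
Proof.
rewrite /GSD trunc_expnK //; split=> //.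
have := twisted_exact (@torus_retraction 'F_2 L L_gt0) a.
rewrite -map_css_D1 -map_css_D2 => -[s [g [kers kerg img]]].
rewrite rho_twist_vec.
(* [s] and [g] are linear for the homology module, which [HZ] unfolds to; naming [HZ] supplies its
   finite-dimensional structure. *)
exact: (@dim_exact 'F_2 (HZ a L_gt0) 3 _ s g).
Qed.
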